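(* Let $s\in(\tfrac12,1)$, $b\in(0,1)$, $\sigma_1>0>\sigma_2$, $\sigma_3=0$, and fix $\psi^s\in\widetilde H^s(I)$ with $\psi^s(b)=1$. Let $\Phi_1,\Phi_2>0$ be as defined in the context, and assume $\dfrac{|\sigma_2|}{\sigma_1}\neq\dfrac{\Phi_1}{\Phi_2}$. Set $\varepsilon=\operatorname{sign}\big(1-\frac{|\sigma_2|}{\sigma_1}\frac{\Phi_2}{\Phi_1}\big)\in\{-1,1\}$ and define, for $v\in\widetilde H^s(I)$ written as $v=v_0+v(b)\psi^s$ with $v_0(b)=0$, $$Tv=v_0+\varepsilon v(b)\psi^s\ \text{on } I_1,\qquad Tv=-v_0+\varepsilon v(b)\psi^s\ \text{on } I_2.$$ Then $T\in\mathcal L(\widetilde H^s(I))$ is bijective, and there exist a compact operator $K\in\mathcal K(\widetilde H^s(I))$ and constants $\alpha,\beta>0$ such that $$|a^s_{\underline\sigma}(v,Tv)|\ge\alpha\|v\|^2_{\widetilde H^s(I)}-\beta\|Kv\|^2_{\widetilde H^s(I)}\qquad\forall v\in\widetilde H^s(I),$$ i.e. $a^s_{\underline\sigma}$ is weakly T-coercive. Consequently, the operator $A^s:\widetilde H^s(I)\to H^{-s}(I)$, $\langle A^su,v\rangle=a^s_{\underline\sigma}(u,v)$, is Fredholm of index zero, so the problem ''find $u\in\widetilde H^s(I)$ with $a^s_{\underline\sigma}(u,v)=\langle f,v\rangle$ for all $v\in\widetilde H^s(I)$'', $f\in H^{-s}(I)$, is well posed in the Fredholm sense.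
   Context: $I=(0,1)$, $I_1=(0,b)$, $I_2=(b,1)$. For $s\in(0,1)$, $C(s)=\dfrac{2^{2s}s\,\Gamma(s+\frac12)}{\sqrt\pi\,\Gamma(1-s)}$. $\widetilde H^s(I)$ is the space of functions $w$ on $I$ whose extension $\widetilde w$ by zero lies in $H^s(\mathbb R)$, with norm $\|w\|^2_{\widetilde H^s(I)}=\frac{C(s)}2\iint_{\mathbb R^2}\frac{|\widetilde w(x)-\widetilde w(y)|^2}{|x-y|^{1+2s}}\,\mathrm dy\,\mathrm dx$; $H^{-s}(I)$ is its dual. For $s>\frac12$ its elements are continuous. The coefficient $\underline\sigma(x,y)$ is symmetric ($\underline\sigma(x,y)=\underline\sigma(y,x)$) with $\underline\sigma=\sigma_1$ on $I_1\times(I_1\cup(\mathbb R\setminus I))$, $\underline\sigma=\sigma_2$ on $I_2\times(I_2\cup(\mathbb R\setminus I))$, $\underline\sigma=\sigma_3$ on $I_1\times I_2$. The form is $a^s_{\underline\sigma}(u,v)=\frac{C(s)}2\iint_{\mathbb R^2}\underline\sigma(x,y)\frac{(\widetilde u(x)-\widetilde u(y))(\widetilde v(x)-\widetilde v(y))}{|x-y|^{1+2s}}\,\mathrm dy\,\mathrm dx$. With $|w|^2_{H^s(I_i)}=\frac{C(s)}2\int_{I_i}\int_{I_i}\frac{|w(x)-w(y)|^2}{|x-y|^{1+2s}}\mathrm dy\,\mathrm dx$ and $\omega(x)=\int_{\mathbb R\setminus I}\frac{\mathrm dy}{|x-y|^{1+2s}}$, define $\Phi_i=\frac{2}{C(s)}|\psi^s|^2_{H^s(I_i)}+2\int_{I_i}|\psi^s(x)|^2\omega(x)\,\mathrm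 dx$ for $i=1,2$. *)

(* Defs.v *)
From mathcomp Require Import all_boot all_order all_algebra.
From mathcomp Require Import all_classical all_reals all_analysis.
Set Implicit Arguments. Unset Strict Implicit. Unset Printing Implicit Defensive.
Import Order.TTheory GRing.Theory Num.Theory numFieldNormedType.Exports.
Local Open Scope classical_set_scope.
Local Open Scope ring_scope.

Section Defs.
Variable R : realType.
Notation leb := (@lebesgue_measure R).

Definition Gamma (z : R) : R :=
  Rintegral leb [set t | 0 < t] (fun t => t `^ (z - 1) * expR (- t)).

Definition Cs (s : R) : R :=
  2 `^ (2 * s) * s * Gamma (s + 2^-1) / (Num.sqrt pi * Gamma (1 - s)).

Definition I_ : set R := [set x | 0 < x < 1].
Definition I1 (b : R) : set R := [set x | 0 < x < b].
Definition I2 (b : R) : set R := [set x | b < x < 1].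

Definition kern (s x y : R) : R := (`|x - y| `^ (1 + 2 * s))^-1.

Definition gagliardo (s : R) (w : R -> R) : \bar R :=
  (\int[leb]_x \int[leb]_y ((w x - w y) ^+ 2 * kern s x y)%:E)%E.

Definition Hnorm2 (s : R) (w : R -> R) : R := Cs s / 2 * fine (gagliardo s w).

(* tilde H^s(I), s > 1/2: (continuous representatives of) functions on R
   vanishing outside I whose Gagliardo double integral is finite *)
Definition Hts (s : R) : set (R -> R) :=
  [set w | continuous w /\ (forall x, ~ I_ x -> w x = 0) /\
           (gagliardo s w < +oo)%E].

Definition sigma (b s1 s2 s3 : R) (x y : R) : R :=
  if `[< I1 b x /\ (I1 b y \/ ~ I_ y) >] || `[< I1 b y /\ ~ I_ x >] then s1
  else if `[< I2 b x /\ (I2 b y \/ ~ I_ y) >] || `[< I2 b y /\ ~ I_ x >] then s2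
  else if `[< (I1 b x /\ I2 b y) \/ (I2 b x /\ I1 b y) >] then s3
  else 0.

Definition aform (s b s1 s2 s3 : R) (u v : R -> R) : R :=
  Cs s / 2 * Rintegral leb setT (fun x => Rintegral leb setT (fun y =>
    sigma b s1 s2 s3 x y * ((u x - u y) * (v x - v y)) * kern s x y)).

Definition seminorm2_on (s : R) (D : set R) (w : R -> R) : R :=
  Cs s / 2 * Rintegral leb D (fun x => Rintegral leb D (fun y =>
    (w x - w y) ^+ 2 * kern s x y)).

Definition omega (s x : R) : R := Rintegral leb (~` I_) (fun y => kern s x y).

Definition Phi (s : R) (D : set R) (psi : R -> R) : R :=
  2 / Cs s * seminorm2_on s D psi +
  2 * Rintegral leb D (fun x => psi x ^+ 2 * omega s x).

Definition epsT (s b s1 s2 : R) (psi : R -> R) : R :=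
  Num.sg (1 - `|s2| / s1 * (Phi s (I2 b) psi / Phi s (I1 b) psi)).

Definition Tmap (s b s1 s2 : R) (psi : R -> R) (v : R -> R) : R -> R :=
  fun x => let v0 := v x - v b * psi x in
    if b < x then - v0 + epsT s b s1 s2 psi * v b * psi x
    else v0 + epsT s b s1 s2 psi * v b * psi x.

Definition bounded_linear_op (s : R) (L : (R -> R) -> (R -> R)) : Prop :=
  (forall v, Hts s v -> Hts s (L v)) /\
  (forall u v (c : R), Hts s u -> Hts s v ->
      L (fun x => c * u x + v x) = (fun x => c * L u x + L v x)) /\
  (exists M : R, forall v, Hts s v -> Hnorm2 s (L v) <= M * Hnorm2 s v).

(* compact operator: bounded linear, and the image of every bounded sequence
   has a Cauchy (hence, by completeness, convergent) subsequence *)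
Definition compact_op (s : R) (K : (R -> R) -> (R -> R)) : Prop :=
  bounded_linear_op s K /\
  forall (vn : nat -> R -> R) (M : R), (forall n, Hts s (vn n)) ->
    (forall n, Hnorm2 s (vn n) <= M) ->
    exists phi : nat -> nat, (forall n, (phi n < phi n.+1)%N) /\
      forall e : R, 0 < e -> exists N, forall m n, (N <= m)%N -> (N <= n)%N ->
        Hnorm2 s (fun x => K (vn (phi m)) x - K (vn (phi n)) x) < e.

Definition Hbijective (s : R) (L : (R -> R) -> (R -> R)) : Prop :=
  forall w, Hts s w -> exists v, Hts s v /\ L v = w /\
    forall v', Hts s v' -> L v' = w -> v' = v.

Definition Hdual (s : R) (f : (R -> R) -> R) : Prop :=
  (forall u v (c : R), Hts s u -> Hts s v ->
      f (fun x => c * u x + v x) = c * f u + f v) /\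
  (exists M : R, forall v, Hts s v -> `|f v| ^+ 2 <= M * Hnorm2 s v).

(* The operator A : tilde H^s(I) -> H^{-s}(I), <A u, v> = a(u,v), is Fredholm
   of index zero: dim ker A = n = codim range A for some n. *)
Definition fredholm_index0 (s : R) (a : (R -> R) -> (R -> R) -> R) : Prop :=
  exists n : nat,
    (exists e : 'I_n -> R -> R,
       (forall i, Hts s (e i) /\ forall v, Hts s v -> a (e i) v = 0) /\
       (forall c : 'I_n -> R,
          (fun x => \sum_(i < n) c i * e i x) = (fun _ => 0) -> forall i, c i = 0) /\
       (forall u, Hts s u -> (forall v, Hts s v -> a u v = 0) ->
          exists c : 'I_n -> R, u = (fun x => \sum_(i < n) c i * e i x))) /\
    (exists g : 'I_n -> (R -> R) -> R,
       (forall i, Hdual s (g i)) /\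
       (forall f, Hdual s f -> exists u (c : 'I_n -> R), Hts s u /\
          forall v, Hts s v -> f v = a u v + \sum_(i < n) c i * g i v) /\
       (forall u (c : 'I_n -> R), Hts s u ->
          (forall v, Hts s v -> a u v + \sum_(i < n) c i * g i v = 0) ->
          forall i, c i = 0)).

End Defs.

(* Main.v *)
(* The analytic input is Hardy's inequality on a half-line for functions vanishing at its
   endpoint, valid since s > 1/2; it bounds the interaction energy across b, so that the two
   one-sided energies control the whole norm. Hence the form S with the coefficient
   |sigma| is coercive although sigma_3 = 0. If w(b) = 0 and [flip w] changes the sign of w
   to the right of b, then a(u, flip w) = S(u, w). Therefore a(v, T v) differs from
   S(v_0, v_0) only by terms controlled by v(b), which the rank-one operator
   K v = v(b) psi absorbs. For the Fredholm property let S(h, w) = w(b), by Riesz: every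
   functional is solved up to a multiple of the evaluation at b, and the kernel of a lies in
   the line of h, so kernel and cokernel are both trivial or both of dimension one according
   to whether a(h, psi) is nonzero. *)
Require Import Defs.
From mathcomp Require Import all_boot all_order all_algebra.
From mathcomp Require Import all_classical all_reals all_analysis.
From mathcomp Require Import measurable_realfun ring lra.
Import Order.TTheory GRing.Theory Num.Theory numFieldNormedType.Exports.
Local Open Scope classical_set_scope.
Local Open Scope ring_scope.

(** * Measurability and affine changes of variables *)

Section Integration.
Variable R : realType.
Notation leb := (@lebesgue_measure R).

(** Changing the sign of a test function on one side of b makes the form positive, but it creates a
    jump unless the function vanishes at b; hence T flips only v_0 and treats the line of psi
    separately, where a(psi, psi) may have either sign. The ratio hypothesis enters through eps: the
    number under the sign is nonzero, so eps^2 = 1 and T is an involution, hence bijective.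

    Hardy's inequality comes from comparing u(x) with u(t x): under the weight |x|^(-2s), dilation
    by t < 1 contracts because s > 1/2, and averaging over t produces the Gagliardo kernel. The same
    inequality bounds point values by the energy, so evaluation at b is a bounded functional and
    energy-Cauchy sequences converge uniformly; this gives the completeness that Riesz' theorem
    requires.

    [Rintegral] is [fine] of an extended integral and sends +oo to 0, so finiteness has to precede
    linearity of the forms, and also positivity of Gamma, which gives C(s) > 0. *)

Lemma measurable_fun_bool_real d (T : measurableType d) (D : set T) (f : T -> bool) :
  measurable_fun D f -> measurable_fun D (fun x => (f x)%:R : R).
Proof.
move=> mf; rewrite -[X in measurable_fun _ X]/((fun c : bool => c%:R : R) \o f).
by apply: measurableT_comp.
Qed.

Lemma measurable_fun_powR d (T : measurableType d) (D : set T) (f : T -> R) p :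
  measurable_fun D f -> measurable_fun D (fun x => f x `^ p).
Proof. by move=> mf; apply: (measurableT_comp (measurable_powR p)). Qed.

Lemma measurable_fun_norm d (T : measurableType d) (D : set T) (f : T -> R) :
  measurable_fun D f -> measurable_fun D (fun x => `|f x|).
Proof. by move=> mf; apply: measurableT_comp. Qed.

Lemma kernE s (x y : R) : kern s x y = `|x - y| `^ (- (1 + 2 * s)).
Proof. by rewrite /kern powRN. Qed.

Lemma kern_ge0 s (x y : R) : 0 <= kern s x y.
Proof. by rewrite kernE powR_ge0. Qed.

Lemma measurable_fun_kern d (T : measurableType d) (D : set T) (f g : T -> R) s :
  measurable_fun D f -> measurable_fun D g ->
  measurable_fun D (fun x => kern s (f x) (g x)).
Proof.
move=> mf mg; under eq_fun do rewrite kernE.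
by apply/measurable_fun_powR/measurable_fun_norm/measurable_funB.
Qed.

Lemma affine_preimage_ocitv (c d a b : R) : 0 < c ->
  (fun x => c * x + d) @^-1` `]a, b] = `](a - d) / c, (b - d) / c]%classic.
Proof.
move=> c0; apply/seteqP; split => x /=; rewrite !in_itv/=.
  by rewrite ltr_pdivrMr// ler_pdivlMr// ltrBlDr lerBrDr mulrC.
by rewrite ltr_pdivrMr// ler_pdivlMr// ltrBlDr lerBrDr mulrC.
Qed.

Lemma measurable_affine (c d : R) : measurable_fun setT (fun x : R => c * x + d).
Proof. by apply: measurable_funD => //; apply: measurable_funM. Qed.

(** Uniqueness of Lebesgue measure: [c] times its image under [x |-> c x + d] gives every half-open
    interval its length, so it is Lebesgue measure itself. *)
Lemma ge0_integral_affine_pos (c d : R) (f : R -> \bar R) : 0 < c ->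
  measurable_fun setT f -> (forall x, (0 <= f x)%E) ->
  (\int[leb]_x f (c * x + d)%R = (c^-1)%:E * \int[leb]_x f x)%E.
Proof.
move=> c0 mf f0.
pose phi := (fun x : R => c * x + d) : measurableTypeR R -> measurableTypeR R.
have mphi : measurable_fun setT phi by exact: measurable_affine.
pose k : {nonneg R} := NngNum (ltW c0).
pose mu' := mscale k (pushforward leb phi).
have E A : measurable A -> leb A = mu' mphi A.
  apply: (@lebesgue_measure_unique R (mu' mphi)) => //= _ [[a b]] _ <-.
  rewrite /mu' /mscale/= /pushforward affine_preimage_ocitv//=.
  rewrite !lebesgue_measure_itv/= !lte_fin ltr_pM2r ?invr_gt0// ltrD2r.
  case: ifPn => _; last by rewrite mule0.
  rewrite -!EFinB -EFinM; congr EFin.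
  by rewrite -mulrBl mulrC -mulrA mulVf ?gt_eqF// mulr1; ring.
have -> : (\int[leb]_x f x = \int[mu' mphi]_x f x)%E.
  by apply: eq_measure_integral => A mA _; exact: E.
rewrite /mu'/= ge0_integral_mscale//= ge0_integral_pushforward//=.
by rewrite muleA -EFinM mulVf ?gt_eqF// mul1e.
Qed.

Lemma ge0_integral_opp (f : R -> \bar R) :
  measurable_fun setT f -> (forall x, (0 <= f x)%E) ->
  (\int[leb]_x f (- x)%R = \int[leb]_x f x)%E.
Proof.
move=> mf f0.
transitivity (\int[pushforward leb (-%R : measurableTypeR R -> measurableTypeR R)]_x f x)%E.
  by rewrite ge0_integral_pushforward.
apply: eq_measure_integral => A mA _; exact: lebesgue_measureN.
Qed.

Lemma ge0_integral_affine (c d : R) (f : R -> \bar R) : c != 0 ->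
  measurable_fun setT f -> (forall x, (0 <= f x)%E) ->
  (\int[leb]_x f (c * x + d)%R = (`|c|^-1)%:E * \int[leb]_x f x)%E.
Proof.
move=> c0 mf f0; have [cp|cn] := ltP 0 c.
  by rewrite gtr0_norm// ge0_integral_affine_pos.
have {cn c0}cn : c < 0 by rewrite lt_neqAle c0.
rewrite ltr0_norm// -(@ge0_integral_affine_pos (- c) d f) ?oppr_gt0//.
rewrite -[RHS]ge0_integral_opp; last by [].
  by under [RHS]eq_integral do rewrite mulrNN.
apply: (measurableT_comp mf); exact: measurable_affine.
Qed.

End Integration.
Ltac meas := cbv beta; lazymatch goal with
  | |- measurable_fun _ (EFin \o _) => apply/measurable_EFinP; meas
  | |- measurable_fun _ (fun x => EFin _) => apply/measurable_EFinP; meas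
  | |- measurable_fun _ (fun x => @?a x * @?b x) => apply: (@measurable_funM _ _ _ _ a b); meas
  | |- measurable_fun _ (fun x => @?a x - @?b x) => apply: (@measurable_funB _ _ _ _ a b); meas
  | |- measurable_fun _ (fun x => @?a x + @?b x) => apply: (@measurable_funD _ _ _ _ a b); meas
  | |- measurable_fun _ (fun x => - @?a x) => apply: (@measurable_funN _ _ _ _ a); meas
  | |- measurable_fun _ (fun x => @?a x ^+ _) => apply: (@measurable_funX _ _ _ _ a); meas
  | |- measurable_fun _ (fun x => @?a x `^ _) => apply: (@measurable_fun_powR _ _ _ _ a); meas
  | |- measurable_fun _ (fun x => `|@?a x|) => apply: (@measurable_fun_norm _ _ _ _ a); meas
  | |- measurable_fun _ (fun x => (nat_of_bool (@?a x))%:R) =>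
      apply: (@measurable_fun_bool_real _ _ _ _ a); meas
  | |- measurable_fun _ (fun x => @?a x && @?b x) => apply: (@measurable_and _ _ _ a b); meas
  | |- measurable_fun _ (fun x => (@?a x < @?b x)%R) => apply: (@measurable_fun_ltr _ _ _ _ a b); meas
  | |- measurable_fun _ (fun x => kern _ (@?a x) (@?b x)) =>
      apply: (@measurable_fun_kern _ _ _ _ a b); meas
  | |- measurable_fun _ (kern _ ?c) =>
      apply: (@measurable_fun_kern _ _ _ _ (fun=> c) (fun x => x)); meas
  | |- measurable_fun _ (fun x => (@?a x <= @?b x)%R) => apply: (@measurable_fun_ler _ _ _ _ a b); meas
  | |- measurable_fun _ (GRing.mul ?c) =>
      apply: (@measurable_funM _ _ _ _ (fun=> c) (fun x => x)); meas
  | |- measurable_fun _ (GRing.add ?c) =>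
      apply: (@measurable_funD _ _ _ _ (fun=> c) (fun x => x)); meas
  | |- measurable_fun _ fst => exact: measurable_fst
  | |- measurable_fun _ snd => exact: measurable_snd
  | H : measurable_fun setT ?u |- measurable_fun _ (fun x => ?u (@?a x)) =>
      apply: (measurableT_comp H); meas
  | |- _ => first [assumption | exact: measurable_cst | exact: measurable_id
                  | exact: measurable_fst | exact: measurable_snd]
  end.

Ltac nneg := repeat first
  [ done | exact: sqr_ge0 | exact: powR_ge0 | exact: kern_ge0 | exact: ler0n | exact: normr_ge0
  | by apply: ltW | apply: mulr_ge0 | apply: addr_ge0 | rewrite invr_ge0 ].

(** * Integrals of nonnegative functions *)

Section NonnegIntegrals.
Context d (T : measurableType d) (R : realType) (mu : {measure set T -> \bar R}).

Lemma ge0_le_integral_EFin (f g : T -> R) : (forall x, 0 <= f x) ->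
  measurable_fun setT f -> measurable_fun setT g -> (forall x, f x <= g x) ->
  (\int[mu]_x (f x)%:E <= \int[mu]_x (g x)%:E)%E.
Proof.
move=> f0 mf mg fg; apply: ge0_le_integral => //; try exact/measurable_EFinP;
  by move=> x _; rewrite lee_fin.
Qed.

Lemma ge0_integralZ_EFin (k : R) (f : T -> R) : 0 <= k -> (forall x, 0 <= f x) ->
  measurable_fun setT f -> (\int[mu]_x (k * f x)%:E = k%:E * \int[mu]_x (f x)%:E)%E.
Proof.
move=> k0 f0 mf; under eq_integral do rewrite EFinM.
by rewrite ge0_integralZl_EFin//; [move=> x _; rewrite lee_fin|exact/measurable_EFinP].
Qed.

Lemma ge0_integralD_EFin (f g : T -> R) : (forall x, 0 <= f x) -> (forall x, 0 <= g x) ->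
  measurable_fun setT f -> measurable_fun setT g ->
  (\int[mu]_x (f x + g x)%:E = \int[mu]_x (f x)%:E + \int[mu]_x (g x)%:E)%E.
Proof.
move=> f0 g0 mf mg; under eq_integral do rewrite EFinD.
by rewrite ge0_integralD//; try (by move=> x _; rewrite lee_fin); exact/measurable_EFinP.
Qed.

(** Fatou's lemma in the form needed three times: for the telescoping in Hardy's inequality, for
    completeness in energy and for the truncated Gamma integrand. *)
Lemma fatou_bound (f : nat -> T -> R) (g : T -> R) (M : \bar R) :
  (forall n x, 0 <= f n x) -> (forall n, measurable_fun setT (f n)) ->
  (forall x, f n x @[n --> \oo] --> g x) ->
  (forall n, (\int[mu]_x (f n x)%:E <= M)%E) ->
  (\int[mu]_x (g x)%:E <= M)%E.
Proof.
move=> f0 mf fg fM.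
have -> : (\int[mu]_x (g x)%:E = \int[mu]_x limn_einf (fun n => (f n x)%:E))%E.
  apply: eq_integral => x _; rewrite (_ : limn_einf _ = (g x)%:E)//.
  apply: (cvg_limn_einf_sup _).1; apply: cvg_EFin; last exact: fg.
  by apply: nearW.
apply: le_trans (fatou _ _ _ _) _ => //.
  by move=> n; apply/measurable_EFinP.
  by move=> n x _; rewrite lee_fin.
rewrite limn_einf_lim; apply: lime_le; first exact: is_cvg_einfs.
apply: nearW => n; apply: le_trans (fM n); apply: ereal_inf_lbound; exists n => //=.
Qed.

End NonnegIntegrals.

Lemma ge0_integral_swap d1 d2 (T1 : measurableType d1) (T2 : measurableType d2)
  (R : realType) (m1 : {sigma_finite_measure set T1 -> \bar R})
  (m2 : {sigma_finite_measure set T2 -> \bar R}) (F : T1 -> T2 -> R) :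
  (forall x y, 0 <= F x y) -> measurable_fun setT (fun z : T1 * T2 => F z.1 z.2) ->
  (\int[m1]_x \int[m2]_y (F x y)%:E = \int[m2]_y \int[m1]_x (F x y)%:E)%E.
Proof.
move=> F0 mF; apply: (fubini_tonelli (fun z => (F z.1 z.2)%:E)) => //=.
  exact/measurable_EFinP.
by move=> z; rewrite lee_fin.
Qed.

Lemma measurable_ge0_integral2 d1 d2 (T1 : measurableType d1) (T2 : measurableType d2)
  (R : realType) (m2 : {sigma_finite_measure set T2 -> \bar R}) (F : T1 -> T2 -> R) :
  (forall x y, 0 <= F x y) -> measurable_fun setT (fun z : T1 * T2 => F z.1 z.2) ->
  measurable_fun setT (fun x => \int[m2]_y (F x y)%:E)%E.
Proof.
move=> F0 mF.
apply: (measurable_fun_fubini_tonelli_F (fun z => (F z.1 z.2)%:E)) => //=.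
  exact/measurable_EFinP.
by move=> z; rewrite lee_fin.
Qed.

(** * Hardy's inequality on a half-line *)

Section Hardy.
Variable R : realType.
Notation leb := (@lebesgue_measure R).
Variables (s sg : R).
Hypothesis s12 : 2^-1 < s.

(** Used with [sg] equal to 1 or -1, so that one argument covers both sides of a point. *)
Definition side (x : R) : R := (0 < sg * x)%R%:R.
Definition hweight (x : R) : R := `|x| `^ (- (2 * s)).
(** A contraction factor: dilation by [t] scales the squared weighted norm by [t^(2s-1)], and
    [t < 1/2] makes this at most [hratio^2]. *)
Definition hratio : R := 2^-1 `^ ((2 * s - 1) / 2).
Definition dilation_diff (u : R -> R) (t : R) (n : nat) (x : R) : R :=
  side x * (u x - u (t ^+ n * x)) ^+ 2 * hweight x.

(** [(1 - hratio)^-2] sums the geometric series; the factor 2 undoes the average over [t] in (0,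
    1/2), an interval of length 1/2. *)
Definition hconst : R := 2 * ((1 - hratio)^-1 / (1 - hratio)).

Let q0 : 0 < hratio. Proof. by rewrite powR_gt0. Qed.

Let q1 : hratio < 1.
Proof.

have := @gt0_ltr_powR R ((2 * s - 1) / 2) _ 2^-1 1; rewrite powR1 /=; apply.
- by rewrite divr_gt0// subr_gt0 -ltr_pdivrMl// mulr1.
- by rewrite nnegrE invr_ge0.
- by rewrite nnegrE.
- by rewrite invf_lt1// ltr1n.
Qed.

(** Convexity of the square, applied with [p = hratio]. The plain bound [2 A^2 + 2 B^2] would cost a
    factor 2 at each dilation and could destroy the geometric decay. *)
Lemma sqr_convex_split (p A B : R) : 0 < p < 1 ->
  (A + B) ^+ 2 <= (1 - p)^-1 * A ^+ 2 + p^-1 * B ^+ 2.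
Proof.
move=> /andP[p0 p1]; have p1' : 0 < 1 - p by rewrite subr_gt0.
rewrite -subr_ge0 (_ : _ - _ = (p * A - (1 - p) * B) ^+ 2 / (p * (1 - p))).
  by rewrite divr_ge0 ?sqr_ge0// mulr_ge0 ?ltW//.
by field; rewrite !gt_eqF.
Qed.

Let chi0 x : 0 <= side x. Proof. by rewrite /side ler0n. Qed.
Let W0 x : 0 <= hweight x. Proof. exact: powR_ge0. Qed.
Let F0 u t n x : 0 <= dilation_diff u t n x.
Proof. by rewrite /dilation_diff; nneg. Qed.

Let mF u t n : measurable_fun setT u -> measurable_fun setT (dilation_diff u t n).
Proof. by move=> mu; rewrite /dilation_diff /side /hweight; meas. Qed.

Let F_step u t n x : 0 < t ->
  dilation_diff u t n.+1 x <= (1 - hratio)^-1 * dilation_diff u t 1%N x + (hratio^-1 * t `^ (2 * s)) * dilation_diff u t n (t * x + 0).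
Proof.
move=> t0; rewrite /dilation_diff expr1 addr0.
have -> : side (t * x) = side x.
  by rewrite /side mulrCA pmulr_rgt0.
have -> : hweight (t * x) = (t `^ (2 * s))^-1 * hweight x.
  by rewrite /hweight normrM powRM// (gtr0_norm t0) powRN.
have -> : t ^+ n.+1 * x = t ^+ n * (t * x) by rewrite exprSr mulrA.
set A := u x - u (t * x); set B := u (t * x) - _.
have -> : u x - u (t ^+ n * (t * x)) = A + B by rewrite /A /B; ring.
have tp : t `^ (2 * s) != 0 by rewrite gt_eqF// powR_gt0.
rewrite [leRHS](_ : _ = side x * ((1 - hratio)^-1 * A ^+ 2 + hratio^-1 * B ^+ 2) * hweight x).
  by rewrite ler_wpM2r// ler_wpM2l// sqr_convex_split// q0.
by field; rewrite tp !gt_eqF ?subr_gt0.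
Qed.

(* Telescoping u x = sum_n (u (t^n x) - u (t^(n+1) x)): dilation by t scales
   the weighted L2 norm by t^((2s-1)/2), so the norms form a geometric series. *)
Let dilation_bound u t n : measurable_fun setT u -> 0 < t < 2^-1 ->
  (\int[leb]_x (dilation_diff u t n x)%:E <= ((1 - hratio)^-1 / (1 - hratio))%:E * \int[leb]_x (dilation_diff u t 1%N x)%:E)%E.
Proof.
move=> mu /andP[t0 t1]; set J := (\int[leb]_x (dilation_diff u t 1%N x)%:E)%E.
have J0 : (0 <= J)%E by apply: integral_ge0 => x _; rewrite lee_fin.
have q1' : 0 < 1 - hratio by rewrite subr_gt0.
(* [M] is the fixed point of [M = (1 - hratio)^-1 + hratio M], so the induction closes with a bound
   independent of [n]. *)
set M := _ / _; have M0 : 0 <= M by rewrite divr_ge0 ?invr_ge0 ?ltW//.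
elim: n => [|n IH].
  rewrite (_ : (\int[leb]_x _)%E = 0)%E ?mule_ge0//.
  by apply: integral0_eq => x _; rewrite /dilation_diff expr0 mul1r subrr expr0n/= mulr0 mul0r.
have k0 : 0 <= hratio^-1 * t `^ (2 * s) by rewrite mulr_ge0 ?powR_ge0 ?invr_ge0 ?ltW//.
have mF1 := mF u t 1%N mu.
have mFt : measurable_fun setT (fun x => dilation_diff u t n (t * x + 0)).
  by apply: (measurableT_comp (mF u t n mu)); exact: measurable_affine.
apply: (@le_trans _ _ (\int[leb]_x ((1 - hratio)^-1 * dilation_diff u t 1%N x + (hratio^-1 * t `^ (2 * s)) * dilation_diff u t n (t * x + 0))%:E)%E).
  apply: ge0_le_integral_EFin => //; [exact: mF| |by move=> x; exact: F_step].
  by meas.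
rewrite ge0_integralD_EFin//; last 4 first.
- by move=> x; nneg.
- by move=> x; nneg.
- by meas.
- by meas.
rewrite !ge0_integralZ_EFin//; last by nneg.
rewrite (@ge0_integral_affine R t 0 (fun x => (dilation_diff u t n x)%:E)) ?gt_eqF//; last 2 first.
- by apply/measurable_EFinP; exact: mF.
- by move=> x; rewrite lee_fin.
rewrite muleA -EFinM gtr0_norm// -/J.
(* One factor [hratio] pays for the weight [hratio^-1] of the convex split, the other remains as
   decay. *)
have kq : hratio^-1 * t `^ (2 * s) * t^-1 <= hratio.
  have -> : hratio^-1 * t `^ (2 * s) * t^-1 = hratio^-1 * t `^ (2 * s - 1).
    rewrite -mulrA; congr (_ * _); rewrite (powRB (s := 1)) ?powRr1 ?(ltW t0)//.
    by rewrite (gt_eqF t0) implybT.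
  rewrite ler_pdivrMl//.
  have -> : hratio * hratio = 2^-1 `^ (2 * s - 1).
    by rewrite /hratio -powRD ?invr_eq0 ?pnatr_eq0 ?implybT//; congr powR; field.
  apply: ge0_ler_powR; rewrite ?nnegrE ?ltW ?invr_gt0//.
  by rewrite subr_gt0 -ltr_pdivrMl// mulr1.
apply: (@le_trans _ _ ((1 - hratio)^-1%:E * J + hratio%:E * (M%:E * J))%E).
  rewrite leeD2l//; apply: lee_pmul; rewrite ?lee_fin//; first by nneg.
  by apply: integral_ge0 => x _; rewrite lee_fin.
rewrite muleA -EFinM -ge0_muleDl ?lee_fin; try by nneg.
rewrite -EFinD (_ : _ + _ = M)// /M; field; by rewrite !gt_eqF.
Qed.

(** Here the vanishing at 0 enters: [t^n x] tends to 0, so [u (t^n x)] drops out of the uniform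
    bound in the limit. *)
Lemma hardy_dilation (u : R -> R) (t : R) : measurable_fun setT u -> u x @[x --> 0] --> 0 -> 0 < t < 2^-1 ->
  (\int[leb]_x (side x * u x ^+ 2 * hweight x)%:E <=
   ((1 - hratio)^-1 / (1 - hratio))%:E * \int[leb]_x (side x * (u x - u (t * x)) ^+ 2 * hweight x)%:E)%E.
Proof.
move=> mu u0 tt; have H n := dilation_bound u t n mu tt.
have E1 : (\int[leb]_x (dilation_diff u t 1 x)%:E = \int[leb]_x (side x * (u x - u (t * x)) ^+ 2 * hweight x)%:E)%E.
  by apply: eq_integral => x _; rewrite /dilation_diff expr1.
have cvF (x : R) : dilation_diff u t n x @[n --> \oo] --> side x * u x ^+ 2 * hweight x.
  have uc : u x - u (t ^+ n * x) @[n --> \oo] --> u x - 0.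
    apply: cvgB; first exact: cvg_cst.
    have tx : t ^+ n * x @[n --> \oo] --> (0 : R).
      rewrite -[X in _ --> X](mul0r x); apply: cvgMr_tmp; apply: cvg_expr.
      by case/andP: tt => t0 t1; rewrite gtr0_norm// (lt_trans t1)// invf_lt1// ltr1n.
    exact: (cvg_comp _ _ tx u0).
  have uc2 := cvgM uc uc; rewrite subr0 -expr2 in uc2.
  rewrite /dilation_diff; apply: cvgMr_tmp; apply: cvgMl_tmp.
  by under eq_fun do rewrite expr2; exact: uc2.
rewrite -E1; apply: fatou_bound H => [n x|n|x] //; exact: mF.
Qed.

(** The dilation estimate is integrated over [t] in (0, 1/2), and [y = t x] is substituted. The
    Jacobian turns the weight into [|x|^-(1+2s)], which the kernel dominates because
    [|x - y| = (1 - t) |x| <= |x|]. *)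
Lemma hardy (u : R -> R) : measurable_fun setT u -> u x @[x --> 0] --> 0 ->
  (\int[leb]_x (side x * u x ^+ 2 * hweight x)%:E <=
   hconst%:E *
   \int[leb]_x \int[leb]_y (side x * side y * (u x - u y) ^+ 2 * kern s x y)%:E)%E.
Proof.
move=> mu u0; set N := (\int[leb]_x _)%E; set Q := (X in (_ <= _ * X)%E).
rewrite /hconst; set M := _ / _; have M0 : 0 <= M by rewrite divr_ge0 ?invr_ge0 ?subr_ge0 ?ltW.
pose c (t : R) : R := ((0 < t) && (t < 2^-1))%:R.
have c0 t : 0 <= c t by rewrite /c ler0n.
pose G t x := c t * (side x * (u x - u (t * x)) ^+ 2 * hweight x).
have G0 t x : 0 <= G t x by rewrite ?/G; nneg.
have mG : measurable_fun setT (fun z : R * R => G z.1 z.2).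
  by rewrite /G /c /side /hweight; meas.
have mG' : measurable_fun setT (fun z : R * R => G z.2 z.1).
  by rewrite /G /c /side /hweight; meas.
have half : (\int[leb]_t (c t)%:E = 2^-1%:E)%E.
  have -> : (\int[leb]_t (c t)%:E = \int[leb]_t (\1_(`]0, 2^-1[%classic) t)%:E)%E.
    apply: eq_integral => t _; rewrite /c indicE; congr (_%:R%:E).
    by rewrite mem_setE in_itv.
  rewrite integral_indic// setIT; apply: etrans (lebesgue_measure_itv `]0, 2^-1[) _.
  by rewrite /= lte_fin invr_gt0 ltr0n/= sube0.
have N0 : (0 <= N)%E by apply: integral_ge0 => x _; rewrite lee_fin; nneg.
have key : (2^-1%:E * N <= M%:E * \int[leb]_t \int[leb]_x (G t x)%:E)%E.
  rewrite -half muleC -ge0_integralZl//; last 2 first.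
    by apply/measurable_EFinP; rewrite /c; meas.
    by move=> t _; rewrite lee_fin.
  rewrite -ge0_integralZl//; last 2 first.
  - exact: measurable_ge0_integral2.
  - by move=> t _; apply: integral_ge0 => x _; rewrite lee_fin.
  apply: ge0_le_integral => //.
  - by move=> t _; rewrite mule_ge0// lee_fin.
  - by apply: emeasurable_funM => //; apply/measurable_EFinP; rewrite /c; meas.
  - by apply: emeasurable_funM => //; exact: measurable_ge0_integral2.
  move=> t _; rewrite /G ge0_integralZ_EFin//; last 2 first.
  - by move=> x; nneg.
  - by rewrite /side /hweight; meas.
  rewrite muleCA muleC; have [tt|tt] := boolP ((0 < t) && (t < 2^-1)).
    by rewrite /c tt !mul1e; exact: hardy_dilation.
  by rewrite /c (negbTE tt) !mul0e.
have key2 : (\int[leb]_t \int[leb]_x (G t x)%:E <= Q)%E.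
  rewrite ge0_integral_swap//; apply: ge0_le_integral => //.
  - by move=> x _; apply: integral_ge0 => t _; rewrite lee_fin.
  - exact: (@measurable_ge0_integral2 _ _ _ _ _ leb (fun x t => G t x) (fun x t => G0 t x) mG').
  - apply: measurable_ge0_integral2; last by rewrite /side; meas.
    by move=> x y; nneg.
  move=> x _; have [x0|x0] := boolP (0 < sg * x); last first.
    rewrite integral0_eq; first by apply: integral_ge0 => y _; rewrite lee_fin; nneg.
    by move=> t _; rewrite /G /side (negbTE x0) !(mul0r,mulr0).
  have xn0 : x != 0 by apply: contraTneq x0 => ->; rewrite mulr0 ltxx.
  (* The integrand in the variable [y = x t]; the factor [c (x^-1 * y)] keeps [y] between 0 and
     [x / 2], hence on the side of [x]. *)
  pose h y := c (x^-1 * y) * ((u x - u y) ^+ 2 * hweight x).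
  have h0 y : 0 <= h y by rewrite /h; nneg.
  have mh : measurable_fun setT h by rewrite /h /c /hweight; meas.
  have -> : (\int[leb]_t (G t x)%:E = \int[leb]_t (h (x * t + 0))%:E)%E.
    apply: eq_integral => t _; rewrite /G /h addr0 mulKf// /side x0 mul1r.
    by rewrite (mulrC t x).
  rewrite (@ge0_integral_affine R x 0 (fun y => (h y)%:E))//; last exact/measurable_EFinP.
  rewrite -ge0_integralZ_EFin// ?invr_ge0//.
  apply: ge0_le_integral_EFin.
  - by move=> y; nneg.
  - by meas.
  - by rewrite /side; meas.
  move=> y; rewrite /h /c; have [/andP[y0 y1]|_] := boolP (_ && _); last first.
    by rewrite mul0r mulr0; nneg.
  have yE : y = x * (x^-1 * y) by rewrite mulVKf.
  move: y0 y1 yE; set t := x^-1 * y => t0 t1 yE.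
  have sy : side y = 1 by rewrite /side yE mulrA mulrC pmulr_rgt0// x0.
  rewrite sy /side x0 !mul1r mulrCA ler_wpM2l ?sqr_ge0//.
  have nx : 0 < `|x| by rewrite normr_gt0.
  have -> : `|x|^-1 * hweight x = (`|x| `^ (1 + 2 * s))^-1.
    rewrite /hweight powRN (@powRD _ _ 1 (2 * s)) ?powRr1 ?ltW// ?invfM//.
    by rewrite (gt_eqF nx) implybT.
  have xy : `|x - y| = (1 - t) * `|x|.
    have -> : x - y = (1 - t) * x by rewrite {1}yE; ring.
    by rewrite normrM gtr0_norm// subr_gt0 (lt_trans t1)// invf_lt1// ltr1n.
  have t1' : 0 < 1 - t by rewrite subr_gt0 (lt_trans t1)// invf_lt1// ltr1n.
  rewrite /kern lef_pV2 ?posrE ?powR_gt0// ?xy ?mulr_gt0//.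
  apply: ge0_ler_powR; rewrite ?nnegrE ?mulr_ge0 ?ltW//.
    by rewrite addr_gt0// mulr_gt0// (lt_trans _ s12)// invr_gt0.
  by rewrite gtr_pMl// ltrBlDr ltrDl.
rewrite EFinM -muleA.
have -> : N = (2%:E * (2^-1%:E * N))%E by rewrite muleA -EFinM divff ?mul1e// pnatr_eq0.
apply: lee_wpmul2l; first by rewrite lee_fin.
by apply: (le_trans key); apply: lee_wpmul2l; [rewrite lee_fin|exact: key2].
Qed.

End Hardy.

(** * Hardy's inequality at a point and the tail of the kernel *)

Section Gluing.
Variable R : realType.
Notation leb := (@lebesgue_measure R).
Notation mu2 := (leb \x leb)%E.
Variable s : R.
Hypothesis s12 : 2^-1 < s.

Definition energy_density (w : R -> R) (x y : R) : R := (w x - w y) ^+ 2 * kern s x y.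

Definition side_energy sg b (w : R -> R) : \bar R :=
  (\int[mu2]_z (side R sg (z.1 - b) * side R sg (z.2 - b) *
     energy_density w z.1 z.2)%:E)%E.

Lemma energy_density_ge0 w x y : 0 <= energy_density w x y.
Proof. by rewrite mulr_ge0 ?sqr_ge0 ?kern_ge0. Qed.

Lemma hweight_ge0 x : 0 <= hweight R s x. Proof. exact: powR_ge0. Qed.

Lemma ge0_integral_prod (F : R -> R -> R) : (forall x y, 0 <= F x y) ->
  measurable_fun setT (fun z : R * R => F z.1 z.2) ->
  (\int[mu2]_z (F z.1 z.2)%:E = \int[leb]_x \int[leb]_y (F x y)%:E)%E.
Proof.
move=> F0 mF; apply: (@fubini_tonelli1 _ _ _ _ R leb leb (fun z => (F z.1 z.2)%:E)) => //=.
  exact/measurable_EFinP.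
by move=> z; rewrite lee_fin.
Qed.

Lemma ge0_integral_prod_swap (F : R -> R -> R) : (forall x y, 0 <= F x y) ->
  measurable_fun setT (fun z : R * R => F z.1 z.2) ->
  (\int[mu2]_z (F z.1 z.2)%:E = \int[leb]_y \int[leb]_x (F x y)%:E)%E.
Proof. by move=> F0 mF; rewrite ge0_integral_prod// ge0_integral_swap. Qed.

Lemma measurable_energy_density w : measurable_fun setT w ->
  measurable_fun setT (fun z : R * R => energy_density w z.1 z.2).
Proof. by move=> mw; rewrite /energy_density; meas. Qed.

Lemma measurable_side_energy sg sg' b b' w : measurable_fun setT w ->
  measurable_fun setT (fun z : R * R => side R sg (z.1 - b) * side R sg' (z.2 - b') *
     energy_density w z.1 z.2).
Proof. by move=> mw; rewrite /energy_density /side; meas. Qed.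

Lemma gagliardoE w : measurable_fun setT w ->
  gagliardo s w = (\int[mu2]_z (energy_density w z.1 z.2)%:E)%E.
Proof.
move=> mw; rewrite ge0_integral_prod//; first exact: energy_density_ge0.
exact: measurable_energy_density.
Qed.

Lemma ge0_integral_translate (b : R) (f : R -> \bar R) :
  measurable_fun setT f -> (forall x, (0 <= f x)%E) ->
  (\int[leb]_x f x = \int[leb]_x f (x + b)%R)%E.
Proof.
move=> mf f0; transitivity ((`|1|^-1)%:E * \int[leb]_x f x)%E.
  by rewrite normr1 invr1 mul1e.
rewrite -(ge0_integral_affine _ 1 b)// ?oner_neq0//.
by apply: eq_integral => x _; rewrite mul1r.
Qed.

Lemma hardy_at sg b (w : R -> R) : continuous w ->
  (\int[leb]_x (side R sg (x - b) * (w x - w b) ^+ 2 * hweight R s (x - b))%:E <=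
   (hconst R s)%:E * side_energy sg b w)%E.
Proof.
move=> cw; have mw : measurable_fun setT w by exact: continuous_measurable_fun.
pose u x := w (x + b) - w b.
have mu : measurable_fun setT u by rewrite /u; meas.
have u0 : u x @[x --> 0] --> 0.
  rewrite -[X in _ --> X](subrr (w b)); apply: cvgB; last exact: cvg_cst.
  have xb : x + b @[x --> (0 : R)] --> 0 + b by apply: cvgD; [exact: cvg_id|exact: cvg_cst].
  by rewrite add0r in xb; exact: (cvg_comp _ _ xb (cw b)).
have -> : (\int[leb]_x (side R sg (x - b) * (w x - w b) ^+ 2 * hweight R s (x - b))%:E =
    \int[leb]_x (side R sg x * u x ^+ 2 * hweight R s x)%:E)%E.
  rewrite [LHS](ge0_integral_translate b).
  - by apply: eq_integral => x _; rewrite addrK.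
  - by rewrite /side /hweight; meas.
  - by move=> x; rewrite lee_fin; nneg.
have e0 x y : 0 <= side R sg (x - b) * side R sg (y - b) * energy_density w x y.
  by nneg.
have me := @measurable_side_energy sg sg b b w mw.
have -> : side_energy sg b w = (\int[leb]_x \int[leb]_y
    (side R sg x * side R sg y * (u x - u y) ^+ 2 * kern s x y)%:E)%E.
  rewrite /side_energy (ge0_integral_prod (fun x y => side R sg (x - b) * side R sg (y - b) * energy_density w x y))//.
  rewrite [LHS](ge0_integral_translate b).
  - apply: eq_integral => x _; rewrite [LHS](ge0_integral_translate b).
    + apply: eq_integral => y _; rewrite /energy_density /u !addrK /kern.
      have -> : x + b - (y + b) = x - y by ring.
      have -> : w (x + b) - w b - (w (y + b) - w b) = w (x + b) - w (y + b) by ring.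
      by rewrite !mulrA.
    + by rewrite /energy_density /side; meas.
    + by move=> y; rewrite lee_fin.
  - by apply: (@measurable_ge0_integral2 _ _ (measurableTypeR R) (measurableTypeR R) R leb (fun x y => side R sg (x - b) * side R sg (y - b) * energy_density w x y)).
  - by move=> x; apply: integral_ge0 => y _; rewrite lee_fin.
exact: hardy.
Qed.

(** Since [1 + 2 s >= 2], the integrand lies below [1 / (1 + z^2)]; this is the origin of the [pi]
    in [gconst]. *)
Lemma integral_tail_le : (\int[leb]_z ((0 <= z)%R%:R * `|1 + z| `^ (- (1 + 2 * s)))%:E <= (pi / 2)%:E)%E.
Proof.
rewrite -integral0y_oneDsqr [leRHS]integral_mkcond.
apply: ge0_le_integral => //; try by move=> x _; rewrite lee_fin; nneg.
- apply/measurable_EFinP; apply: measurable_funM.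
    by apply: measurable_fun_bool_real; apply: measurable_fun_ler; meas.
  by meas.
- apply: (iffLR (measurable_restrictT _ _)) => //; apply/measurable_EFinP.
  apply: measurable_funTS; apply: continuous_measurable_fun; exact: continuous_oneDsqrV.
move=> z _; rewrite patchE mem_setE in_itv/= andbT; case: ifPn => z0; last first.
  by rewrite mul0r.
rewrite mul1r lee_fin powRN lef_pV2 ?posrE ?powR_gt0 ?oneDsqr_gt0 ?normr_gt0 ?gt_eqF// ?ltr_wpDr//.
rewrite ger0_norm ?addr_ge0//.
apply: (@le_trans _ _ ((1 + z) `^ 2%:R)).
  by rewrite powR_mulrn ?addr_ge0// /oneDsqr sqrrD expr1n mul1r lerD2r lerDl mulrn_wge0.
apply: ler_powR; first by rewrite lerDl.
by rewrite -[leLHS]/(1 + 1) lerD2l -ler_pdivrMl// mulr1 ltW.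
Qed.

(** The substitution [y = b - sg r z] with [r = |x - b|] gives [x - y = sg r (1 + z)]; homogeneity
    extracts [r r^-(1+2s)] and leaves the tail integral. *)
Lemma integral_kern_side_le sg b x : sg ^+ 2 = 1 -> 0 < sg * (x - b) ->
  (\int[leb]_y ((sg * (y - b) <= 0)%R%:R * kern s x y)%:E <= (pi / 2 * hweight R s (x - b))%:E)%E.
Proof.
move=> sg1 xb; pose r := sg * (x - b).
have {}xb : 0 < r by [].
have sg0 : sg != 0 by apply: contra_eq_neq sg1 => ->; rewrite expr0n/= eq_sym oner_neq0.
have nsg : `|sg| = 1.
  by move/eqP: sg1; rewrite sqrf_eq1 => /orP[]/eqP->; rewrite ?normrN normr1.
have xE : x = b + sg * r by rewrite /r mulrA -expr2 sg1 mul1r; ring.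
clearbody r.
pose G y := (sg * (y - b) <= 0)%R%:R * kern s x y.
have G0 y : 0 <= G y by rewrite /G; apply: mulr_ge0; [exact: ler0n|exact: kern_ge0].
have mG : measurable_fun setT G.
  rewrite /G; apply: measurable_funM; last by meas.
  by apply: measurable_fun_bool_real; apply: measurable_fun_ler; meas.
have c0 : - sg * r != 0 by rewrite mulf_neq0 ?oppr_eq0// (gt_eqF xb).
have nc : `|- sg * r| = r by rewrite normrM normrN nsg mul1r gtr0_norm.
have := @ge0_integral_affine R (- sg * r) b (fun y => (G y)%:E) c0.
rewrite nc => /(_ _ _)/esym H.
have {H} -> : (\int[leb]_y (G y)%:E = r%:E * \int[leb]_z (G (- sg * r * z + b))%:E)%E.
  rewrite -H; last 2 first.
  - exact/measurable_EFinP.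
  - by move=> y; rewrite lee_fin.
  by rewrite muleA -EFinM divff ?mul1e// gt_eqF.
have -> : (\int[leb]_z (G (- sg * r * z + b))%:E =
   (r `^ (1 + 2 * s))^-1%:E * \int[leb]_z ((0 <= z)%R%:R * `|1 + z| `^ (- (1 + 2 * s)))%:E)%E.
  rewrite -ge0_integralZ_EFin; last 3 first.
  - by nneg.
  - by move=> z; nneg.
  - apply: measurable_funM.
      apply: measurable_fun_bool_real; apply: measurable_fun_ler; meas.
    by meas.
  apply: eq_integral => z _; rewrite /G addrK.
  have -> : sg * (- sg * r * z) = - (r * z) by rewrite -[in RHS](mul1r r) -sg1; ring.
  rewrite oppr_le0 pmulr_rge0// kernE.
  have -> : x - (- sg * r * z + b) = sg * r * (1 + z) by rewrite {1}xE; ring.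
  by rewrite !normrM nsg mul1r (gtr0_norm xb) (powRM _ (ltW xb) (normr_ge0 _)) [in RHS]mulrCA -powRN.
rewrite muleA -EFinM.
have -> : r * (r `^ (1 + 2 * s))^-1 = hweight R s (x - b).
  rewrite /hweight powRN.
  have -> : `|x - b| = r by rewrite xE addrAC subrr add0r normrM nsg mul1r gtr0_norm.
  rewrite (@powRD _ _ 1 (2 * s)) ?powRr1 ?ltW//; last by rewrite (gt_eqF xb) implybT.
  by rewrite invfM mulVKf// gt_eqF.
rewrite (mulrC (pi / 2)) EFinM; apply: lee_wpmul2l; first by rewrite lee_fin hweight_ge0.
exact: integral_tail_le.
Qed.

End Gluing.

(** * Control of the full energy by the two one-sided energies *)

Section GluingEstimate.
Variable R : realType.
Notation leb := (@lebesgue_measure R).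
Notation mu2 := (leb \x leb)%E.
Variable s : R.
Hypothesis s12 : 2^-1 < s.

(** The share of [w x - w b] in the interaction of [x] with a [y] on the other side of [b]. The case
    [y = b] is included, so that the pointwise estimate of the energy density has no exceptional
    points. *)
Definition cross_density sg b (w : R -> R) (x y : R) : R :=
  side R sg (x - b) * (w x - w b) ^+ 2 * ((sg * (y - b) <= 0)%R%:R * kern s x y).

Lemma cross_density_ge0 sg b w x y : 0 <= cross_density sg b w x y.
Proof. by rewrite /cross_density; nneg. Qed.

Lemma measurable_cross_density sg b w : measurable_fun setT w ->
  measurable_fun setT (fun z : R * R => cross_density sg b w z.1 z.2).
Proof. by move=> mw; rewrite /cross_density /side; meas. Qed.

Lemma measurable_cross_density_swap sg b w : measurable_fun setT w ->
  measurable_fun setT (fun z : R * R => cross_density sg b w z.2 z.1).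
Proof. by move=> mw; rewrite /cross_density /side; meas. Qed.

Lemma hconst_ge0 : 0 <= hconst R s.
Proof. by rewrite /hconst; apply: mulr_ge0 => //; rewrite -expr2 sqr_ge0. Qed.

(** For fixed [x] the kernel integrates in [y] to at most [pi / 2] times the Hardy weight at
    [x - b]; then Hardy's inequality at [b] applies. *)
Lemma integral_cross_density_le sg b (w : R -> R) : sg ^+ 2 = 1 -> continuous w ->
  (\int[leb]_x \int[leb]_y (cross_density sg b w x y)%:E <=
    (pi / 2 * hconst R s)%:E * side_energy R s sg b w)%E.
Proof.
move=> sg1 cw; have mw : measurable_fun setT w by exact: continuous_measurable_fun.
have pi0 : 0 <= pi / 2 :> R by rewrite divr_ge0 ?pi_ge0.
rewrite EFinM -muleA.
apply: (le_trans _ (lee_wpmul2l _ (hardy_at R s s12 sg b w cw))); last by rewrite lee_fin.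
rewrite -ge0_integralZ_EFin//; last 2 first.
- by move=> x; nneg.
- by rewrite /side /hweight; meas.
apply: ge0_le_integral => //.
- by move=> x _; apply: integral_ge0 => y _; rewrite lee_fin cross_density_ge0.
- apply: (@measurable_ge0_integral2 _ _ (measurableTypeR R) (measurableTypeR R) R leb
    (cross_density sg b w)).
    exact: cross_density_ge0.
  exact: measurable_cross_density.
- by apply/measurable_EFinP; rewrite /side /hweight; meas.
move=> x _; rewrite /cross_density ge0_integralZ_EFin//; last 3 first.
- by nneg.
- by move=> y; nneg.
- by meas.
have [xb|xb] := boolP (0 < sg * (x - b)); last by rewrite /side (negbTE xb) !(mul0r, mulr0) mul0e.
rewrite [X in (_ <= X%:E)%E]mulrCA [X in (_ <= X)%E]EFinM; apply: lee_wpmul2l; first by rewrite lee_fin; nneg.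
exact: integral_kern_side_le.
Qed.

Let sqrD_le2 (a c : R) : (a + c) ^+ 2 <= 2 * a ^+ 2 + 2 * c ^+ 2.
Proof. by rewrite -subr_ge0 (_ : _ - _ = (a - c) ^+ 2) ?sqr_ge0//; ring. Qed.

(** Across [b] the increment passes through [w b], and [(p + q)^2 <= 2 p^2 + 2 q^2] gives the
    factors 2. By symmetry of the kernel, the share of [y] is a cross density with exchanged
    arguments. *)
Lemma energy_density_le b w x y :
  energy_density R s w x y <=
    side R 1 (x - b) * side R 1 (y - b) * energy_density R s w x y +
    side R (-1) (x - b) * side R (-1) (y - b) * energy_density R s w x y +
    (2 * (cross_density 1 b w x y + cross_density (-1) b w x y) +
     2 * (cross_density 1 b w y x + cross_density (-1) b w y x)).
Proof.
have k0 := kern_ge0 R s x y.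
have ks : kern s y x = kern s x y by rewrite /kern distrC.
have e2 : energy_density R s w x y <=
    2 * ((w x - w b) ^+ 2 * kern s x y) + 2 * ((w y - w b) ^+ 2 * kern s x y).
  rewrite [leRHS](_ : _ = (2 * (w x - w b) ^+ 2 + 2 * (w y - w b) ^+ 2) * kern s x y); last by ring.
  rewrite /energy_density ler_wpM2r//.
  have -> : w x - w y = (w x - w b) + (w b - w y) by ring.
  by rewrite -(sqrrN (w y - w b)) opprB.
have a0 : 0 <= (w x - w b) ^+ 2 * kern s x y by nneg.
have c0 : 0 <= (w y - w b) ^+ 2 * kern s x y by nneg.
have E0 := energy_density_ge0 R s w x y.
have Ex : x = b -> energy_density R s w x y = (w y - w b) ^+ 2 * kern s x y.
  by move=> ->; rewrite /energy_density -sqrrN opprB.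
have Ey : y = b -> energy_density R s w x y = (w x - w b) ^+ 2 * kern s x y.
  by move=> ->.
rewrite /cross_density /side !mul1r !mulN1r !oppr_gt0 !oppr_le0 !subr_gt0 !subr_lt0 !subr_le0 !subr_ge0 !ks.
have [xb|xb|xb] := ltgtP x b; have [yb|yb|yb] := ltgtP y b;
  rewrite ?xb ?yb ?ltxx ?lexx /= ?(mul1r, mul0r, addr0, add0r, mulr0);
  first [lra | have := Ex xb; have := Ey yb | have := Ex xb | have := Ey yb]; subst; lra.
Qed.

(** With [c = (pi / 2) hconst], pairs on one side contribute 1 and the cross terms contribute [2 c]
    for each of the two arguments. *)
Definition gconst : R := 1 + 2 * pi * hconst R s.

Lemma gconst_ge0 : 0 <= gconst.
Proof. by rewrite addr_ge0// mulr_ge0 ?hconst_ge0// mulr_ge0// pi_ge0. Qed.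

(* A function continuous at [b] has finite energy as soon as its two halves do:
   the interaction across [b] is bounded by Hardy's inequality for [w - w b]. *)
Lemma gagliardo_le_sides b (w : R -> R) : continuous w ->
  (gagliardo s w <= gconst%:E * (side_energy R s 1 b w + side_energy R s (-1) b w))%E.
Proof.
move=> cw; have mw : measurable_fun setT w by exact: continuous_measurable_fun.
have mc sg := measurable_cross_density sg b w mw.
have mc' sg := measurable_cross_density_swap sg b w mw.
have ms sg := measurable_side_energy R s sg sg b b w mw.
have c0 sg x y := cross_density_ge0 sg b w x y.
have S0 sg x y : 0 <= side R sg (x - b) * side R sg (y - b) * energy_density R s w x y by nneg.
have m2 (f g : R * R -> R) : measurable_fun setT f -> measurable_fun setT g ->
   measurable_fun setT (fun z => f z + g z) by move=> mf mg; apply: measurable_funD.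
have mk (f : R * R -> R) : measurable_fun setT f -> measurable_fun setT (fun z => 2 * f z).
  by move=> mf; apply: measurable_funM.
rewrite gagliardoE//.
apply: (@le_trans _ _ (\int[mu2]_z (
    side R 1 (z.1 - b) * side R 1 (z.2 - b) * energy_density R s w z.1 z.2 +
    side R (-1) (z.1 - b) * side R (-1) (z.2 - b) * energy_density R s w z.1 z.2 +
    (2 * (cross_density 1 b w z.1 z.2 + cross_density (-1) b w z.1 z.2) +
     2 * (cross_density 1 b w z.2 z.1 + cross_density (-1) b w z.2 z.1)))%:E)%E).
  apply: ge0_le_integral_EFin.
  - by move=> z; exact: energy_density_ge0.
  - exact: measurable_energy_density.
  - by apply: (m2); [apply: (m2)|apply: (m2); apply: (mk); apply: (m2)].
  - by move=> z; exact: energy_density_le.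
have pcs (f g : R * R -> R) : (forall z, 0 <= f z) -> (forall z, 0 <= g z) ->
   forall z, 0 <= f z + g z by move=> f0 g0 z; rewrite addr_ge0.
rewrite ge0_integralD_EFin; [|by apply: pcs|by move=> z; nneg|by apply: (m2)|by apply: (m2); apply: (mk); apply: (m2)].
rewrite ge0_integralD_EFin//.
rewrite ge0_integralD_EFin; [|by move=> z; nneg|by move=> z; nneg|by apply: (mk); apply: (m2)|by apply: (mk); apply: (m2)].
rewrite !ge0_integralZ_EFin//; [|by move=> z; nneg|by apply: (m2)|by move=> z; nneg|by apply: (m2)].
rewrite !ge0_integralD_EFin//.
rewrite !(ge0_integral_prod R (cross_density _ b w))//.
rewrite !(ge0_integral_prod_swap R (fun x y => cross_density _ b w y x))//.
rewrite -!/(side_energy R s _ b w).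
have K sg (sg1 : sg ^+ 2 = 1) := integral_cross_density_le sg b w sg1 cw.
have K1 := K 1 (expr1n _ _); have K2 := K (-1) (etrans (sqrrN 1) (expr1n _ _)).
set Q1 := side_energy R s 1 b w in K1 *; set Q2 := side_energy R s (-1) b w in K2 *.
have Q10 : (0 <= Q1)%E by apply: integral_ge0 => z _; rewrite lee_fin.
have Q20 : (0 <= Q2)%E by apply: integral_ge0 => z _; rewrite lee_fin.
set c := pi / 2 * hconst R s in K1 K2.
have cc0 : 0 <= c by rewrite mulr_ge0 ?hconst_ge0// divr_ge0 ?pi_ge0.
have -> : gconst = 1 + (2 * c + 2 * c) by rewrite /gconst /c; field.
have c20 : 0 <= 2 * c by rewrite mulr_ge0.
have D (e1 e2 : R) : 0 <= e1 -> 0 <= e2 ->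
    ((e1 + e2)%:E * (Q1 + Q2) = e1%:E * (Q1 + Q2) + e2%:E * (Q1 + Q2))%E.
  by move=> e10 e20; rewrite EFinD ge0_muleDl.
have c40 : 0 <= 2 * c + 2 * c by rewrite addr_ge0.
rewrite (D _ _ ler01 c40) (D _ _ c20 c20) mul1e (EFinM 2 c) -muleA.
have KK := leeD K1 K2; rewrite -ge0_muleDr// in KK.
  by apply: leeD => //; apply: leeD; apply: lee_wpmul2l; rewrite ?lee_fin.
all: try first [exact: (mc _)|exact: (mc' _)|exact: (ms _)].
Qed.

(* Hardy at [p], restricted to the region (1, 2), where [w] vanishes. *)
Lemma sup_le_gagliardo (w : R -> R) p : continuous w -> (forall x, ~ I_ x -> w x = 0) ->
  ((w p ^+ 2)%:E <= (2 `^ (2 * s) * hconst R s)%:E * gagliardo s w)%E.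
Proof.
move=> cw w0; have mw : measurable_fun setT w by exact: continuous_measurable_fun.
have G0 : (0 <= gagliardo s w)%E.
  by apply: integral_ge0 => x _; apply: integral_ge0 => y _; rewrite lee_fin; exact: energy_density_ge0.
have C0 : 0 <= 2 `^ (2 * s) * hconst R s by rewrite mulr_ge0 ?powR_ge0 ?hconst_ge0.
have [[p0 p1]|Ip] := pselect (0 < p /\ p < 1); last first.
  rewrite w0; last by rewrite /I_ /= => /andP[? ?]; apply: Ip.
  by rewrite expr0n/= mule_ge0// lee_fin.
have s0 : 0 < 2 * s by rewrite mulr_gt0// (lt_trans _ s12)// invr_gt0.
have H := hardy_at R s s12 1 p w cw.
have H2 : (side_energy R s 1 p w <= gagliardo s w)%E.
  rewrite gagliardoE//; apply: ge0_le_integral_EFin.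
  - by move=> z; nneg.
  - exact: measurable_side_energy.
  - exact: measurable_energy_density.
  - move=> z; rewrite /side; do 2 case: (0 < _); rewrite ?(mul1r, mul0r)//; exact: energy_density_ge0.
(* For [x] in (1, 2) one has [|x - p| < 2], so the Hardy weight is at least [2^(-2s)] on this
   interval of length 1. *)
pose c : R := w p ^+ 2 * 2 `^ (- (2 * s)).
have c0 : 0 <= c by rewrite /c; nneg.
have L : (c%:E <= \int[leb]_x (side R 1 (x - p) * (w x - w p) ^+ 2 * hweight R s (x - p))%:E)%E.
  have -> : (c%:E = \int[leb]_x (c * ((1 < x) && (x < 2))%R%:R)%:E)%E.
    rewrite ge0_integralZ_EFin//; last by meas.
    have -> : (\int[leb]_x (((1 < x) && (x < 2))%R%:R)%:E = \int[leb]_x (\1_(`]1%R, 2%R[%classic) x)%:E)%E.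
      by apply: eq_integral => x _; rewrite indicE mem_setE in_itv.
    rewrite integral_indic// setIT.
    transitivity (c%:E * 1)%E; first by rewrite mule1.
    congr (_ * _)%E; apply/esym; apply: etrans (lebesgue_measure_itv `]1%R, 2%R[) _.
    by rewrite /= lte_fin ltr1n -EFinB; congr EFin; ring.
  apply: ge0_le_integral_EFin.
  - by move=> x; nneg.
  - by meas.
  - by rewrite /side /hweight; meas.
  move=> x; have [/andP[x1 x2]|_] := boolP (_ && _); last by rewrite mulr0; nneg.
  have px : 0 < x - p by rewrite subr_gt0 (lt_trans p1).
  rewrite mulr1 /side mul1r px mul1r (w0 x); last first.
    by rewrite /I_ /= => /andP[_]; rewrite ltNge ltW.
  have n0 : 0 < `|x - p| by rewrite gtr0_norm.
  rewrite sub0r sqrrN /c ler_wpM2l ?sqr_ge0// /hweight !powRN lef_pV2 ?posrE ?powR_gt0//.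
  apply: ge0_ler_powR; rewrite ?nnegrE ?ltW//.
  by rewrite gtr0_norm//; lra.
have {L H}L := le_trans L (le_trans H (lee_wpmul2l _ H2)).
have -> : (w p ^+ 2)%:E = ((2 `^ (2 * s))%:E * c%:E)%E.
  by rewrite -EFinM /c powRN mulrCA divff ?mulr1// gt_eqF// powR_gt0.
rewrite [X in (_ <= X * _)%E]EFinM -muleA; apply: lee_wpmul2l; first by rewrite lee_fin powR_ge0.
by apply: L; rewrite lee_fin hconst_ge0.
Qed.

End GluingEstimate.

(** * Riesz representation for a nonnegative symmetric form *)

Section Riesz.
Variables (R : realType) (T : Type) (V : set (T -> R)) (S : (T -> R) -> (T -> R) -> R).

(** For [c > 0] the value at [t = - e / c] suffices; the cases [c < 0], and [c = 0] with [e]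
    nonzero, contradict the nonnegativity at a suitable [t]. *)
Lemma discriminant_le (a c e : R) : (forall t, 0 <= a + 2 * t * e + t ^+ 2 * c) ->
  e ^+ 2 <= a * c.
Proof.
move=> H; have a0 : 0 <= a by have := H 0; rewrite mulr0 mul0r expr0n/= mul0r !addr0.
have [c0|c0|c0] := ltgtP c 0.
(* Adding the values at [r] and [- r] removes the linear term, while [r >= 1] and [r c = c - a] give
   [a + r^2 c <= a + r c = c < 0]. *)
- pose r := 1 - a / c.
  have rc : r * c = c - a by rewrite /r; field; rewrite lt_eqF.
  have r1 : 1 <= r by rewrite /r lerDl oppr_ge0 mulr_ge0_le0// invr_le0 ltW.
  have h : 0 <= (r ^+ 2 - r) * - c.
    by rewrite mulr_ge0 ?oppr_ge0 ?(ltW c0)// subr_ge0 expr2 ler_peMl// (le_trans ler01).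
  have := H r; have := H (- r); rewrite sqrrN => h1 h2.
  have : 0 <= a + r ^+ 2 * c by move: h1 h2; move: (r ^+ 2 * c) => q; lra.
  rewrite (_ : a + r ^+ 2 * c = (r * c + a) - (r ^+ 2 - r) * - c); last by ring.
  by rewrite rc subrK; move: h; move: ((r ^+ 2 - r) * - c) => q; lra.
- have := H (- e / c); rewrite (_ : _ + _ = (a * c - e ^+ 2) / c); last by field; rewrite gt_eqF.
  by rewrite pmulr_lge0 ?invr_gt0// subr_ge0.
- subst c; rewrite mulr0; have [->|e0] := eqVneq e 0; first by rewrite expr0n.
  have := H (- (a + 1) / (2 * e)); rewrite mulr0 addr0.
  rewrite (_ : _ + _ = -1); last by field.
  by rewrite lerNr oppr0 ler10.
Qed.

Hypothesis Vlin : forall u v c, V u -> V v -> V (fun x => c * u x + v x).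
Hypothesis Ssym : forall u v, S u v = S v u.
Hypothesis Slin : forall u v w c, V u -> V v -> V w ->
  S (fun x => c * u x + v x) w = c * S u w + S v w.
Hypothesis Spos : forall u, V u -> 0 <= S u u.

Lemma form_quadratic u v c : V u -> V v ->
  S (fun x => c * u x + v x) (fun x => c * u x + v x) = S v v + 2 * c * S u v + c ^+ 2 * S u u.
Proof.
move=> Vu Vv; rewrite Slin//; last exact: Vlin.
rewrite (Ssym u) (Ssym v) !Slin// (Ssym v u); ring.
Qed.

Lemma form_cauchy_schwarz u v : V u -> V v -> S u v ^+ 2 <= S u u * S v v.
Proof.
move=> Vu Vv; rewrite mulrC; apply: discriminant_le => t.
by rewrite -form_quadratic//; apply/Spos/Vlin.
Qed.

(** Differences are written [-1 * u + v] so that they are instances of the only closure operation,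
    [c * u + v]. *)
Hypothesis Scomplete : forall u_ : nat -> T -> R, (forall n, V (u_ n)) ->
  (forall e, 0 < e -> exists N, forall m n, (N <= m)%N -> (N <= n)%N ->
     S (fun x => -1 * u_ n x + u_ m x) (fun x => -1 * u_ n x + u_ m x) <= e) ->
  exists2 u, V u & forall e, 0 < e -> exists N, forall n, (N <= n)%N ->
     S (fun x => -1 * u_ n x + u x) (fun x => -1 * u_ n x + u x) <= e.

(* Minimize J v = S v v - 2 f v; along a minimizing sequence the first variation
   tends to 0, since J (v_n + t v) stays above the infimum for every t. *)
Lemma riesz (f : (T -> R) -> R) M v0 : V v0 ->
  (forall u v c, V u -> V v -> f (fun x => c * u x + v x) = c * f u + f v) ->
  (forall v, V v -> f v ^+ 2 <= M * S v v) ->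
  exists2 h, V h & forall v, V v -> S h v = f v.
Proof.
move=> Vv0 flin fM; pose J v := S v v - 2 * f v.
have fM' v : V v -> f v ^+ 2 <= (`|M| + 1) * S v v.
  move=> Vv; apply: (le_trans (fM v Vv)); rewrite ler_wpM2r ?Spos//.
  by rewrite (le_trans (ler_norm M))// lerDl.
set C := `|M| + 1 in fM'; have C0 : 0 < C by rewrite /C ltr_wpDl.
(* Completing the square, with [S v v >= C^-1 (f v)^2] and [C^-1 (f v - C)^2 >= 0]. *)
have Jlb v : V v -> - C <= J v.
  move=> Vv; have := fM' v Vv; rewrite /J -ler_pdivrMl// => H.
  have : 0 <= C^-1 * (f v - C) ^+ 2 by rewrite mulr_ge0 ?sqr_ge0// invr_ge0 ltW.
  have -> : C^-1 * (f v - C) ^+ 2 = C^-1 * f v ^+ 2 - 2 * f v + C by field; rewrite gt_eqF.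
  lra.
pose A := [set J v | v in V].
have hA : has_inf A.
  by split; [exists (J v0), v0|exists (- C) => _ [v Vv <-]; exact: Jlb].
have dJ v : V v -> inf A <= J v by move=> Vv; apply: ge_inf; [exact: hA.2|exists v].
have ex n : exists v, V v /\ J v < inf A + n.+1%:R^-1.
  have [|_ [v Vv <-] Jv] := @inf_adherent _ A n.+1%:R^-1 _ hA; first by rewrite invr_gt0.
  by exists v.
have [v_ /all_and2[Vv_ Jv_]] := choice ex.
have Jq n v t : V v -> J (fun x => t * v x + v_ n x) =
    J (v_ n) + 2 * t * (S (v_ n) v - f v) + t ^+ 2 * S v v.
  by move=> Vv; rewrite /J form_quadratic// flin// (Ssym v); ring.
have inv_small e : 0 < e -> exists N, forall n, (N <= n)%N -> n.+1%:R^-1 <= e :> R.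
  move=> e0; exists (Num.truncn e^-1) => n Nn.
  rewrite -[leRHS]invrK lef_pV2 ?posrE ?invr_gt0// ltW//.
  by apply: (lt_le_trans (truncnS_gt _)); rewrite ler_nat ltnS.
have var n v : V v -> (S (v_ n) v - f v) ^+ 2 <= n.+1%:R^-1 * S v v.
  move=> Vv; apply: discriminant_le => t.
  have := dJ _ (Vlin _ _ t Vv (Vv_ n)); rewrite Jq// => H.
  have := Jv_ n; move: H; move: (J (v_ n)) (inf A) (n.+1%:R^-1) (2 * t * _) (t ^+ 2 * _).
  by move=> a1 a2 a3 a4 a5; lra.
have [u Vu uv] : exists2 u, V u & forall e, 0 < e -> exists N, forall n, (N <= n)%N ->
     S (fun x => -1 * v_ n x + u x) (fun x => -1 * v_ n x + u x) <= e.
  apply: Scomplete => // e e0.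
  (* Parallelogram identity: [S d d / 2 = J (v_m) + J (v_n) - 2 J (midpoint)], which is at most
     [1/(m+1) + 1/(n+1)]; two terms of size [e / 4] give [S d d <= e]. *)
  have e4 : 0 < e / 4 by rewrite divr_gt0.
  have [N HN] := inv_small _ e4; exists N => m n Nm Nn.
  set d := (fun x => -1 * v_ n x + v_ m x).
  have Vd : V d by exact: Vlin.
  have vm : v_ m = (fun x => 1 * d x + v_ n x).
    by apply/funext => x; rewrite /d mul1r mulN1r addrAC addNr add0r.
  have E1 : J (v_ m) = J (v_ n) + 2 * 1 * (S (v_ n) d - f d) + 1 ^+ 2 * S d d.
    by rewrite -Jq// -vm.
  have E2 := Jq n d 2^-1 Vd; have D2 := dJ _ (Vlin _ _ 2^-1 Vd (Vv_ n)).
  have Jm := Jv_ m; have Jn := Jv_ n; have Hm := HN m Nm; have Hn := HN n Nn.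
  rewrite E2 in D2; rewrite E1 in Jm.
  move: D2 Jm Jn Hm Hn; move: (S (v_ n) d - f d) (S d d) (J (v_ n)) (inf A) (m.+1%:R^-1) (n.+1%:R^-1).
  rewrite (_ : 2^-1 ^+ 2 = 4^-1 :> R); last by field.
  by move=> b c a i p q; lra.
exists u => // v Vv; apply/eqP; rewrite -subr_eq0 -sqrf_eq0 eq_le sqr_ge0 andbT.
apply/ler_addgt0Pl => e e0; rewrite addr0.
(* [S u v - f v] splits into [S (u - v_n) v] and the first variation at [v_n]; each will have square
   at most [e / 4]. The [+ 1] in [k] covers [S v v = 0]. *)
pose k := S v v + 1; have k0 : 0 < k by rewrite ltr_wpDl// Spos.
have Sk : S v v <= k by rewrite lerDl.
have e4 : 0 < e / (4 * k) by rewrite divr_gt0// mulr_gt0.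
have [N1 H1] := uv _ e4; have [N2 H2] := inv_small _ e4.
pose n := maxn N1 N2.
have G1 := H1 n (leq_maxl _ _); have G2 := H2 n (leq_maxr _ _).
set w := (fun x => -1 * v_ n x + u x) in G1.
have Vw : V w by exact: Vlin.
have -> : S u v - f v = S w v + (S (v_ n) v - f v) by rewrite /w Slin//; ring.
have F1 : S w v ^+ 2 <= e / 4.
  apply: (le_trans (form_cauchy_schwarz w v Vw Vv)).
  apply: (@le_trans _ _ (e / (4 * k) * k)); last by rewrite le_eqVlt; apply/orP; left; apply/eqP; field; rewrite gt_eqF.
  by apply: ler_pM => //; apply: Spos.
have F2 : (S (v_ n) v - f v) ^+ 2 <= e / 4.
  apply: (le_trans (var n v Vv)).
  apply: (@le_trans _ _ (e / (4 * k) * k)); last by rewrite le_eqVlt; apply/orP; left; apply/eqP; field; rewrite gt_eqF.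
  by apply: ler_pM => //; apply: Spos.
move: F1 F2; move: (S w v) (S (v_ n) v - f v) => p q F1 F2.
have : 0 <= (p - q) ^+ 2 by exact: sqr_ge0.
rewrite sqrrB sqrrD; lra.
Qed.

End Riesz.

(** * Bilinear forms with bounded weight *)

Section BilinearForms.
Variable R : realType.
Notation leb := (@lebesgue_measure R).
Notation mu2 := (leb \x leb)%E.
Variable s : R.

Definition bform (rho : R * R -> R) (u v : R -> R) : R :=
  Rintegral mu2 setT (fun z => rho z * ((u z.1 - u z.2) * (v z.1 - v z.2)) * kern s z.1 z.2).

Definition energy (w : R -> R) : R := fine (gagliardo s w).

Definition finite_energy (w : R -> R) : Prop :=
  measurable_fun setT w /\ (gagliardo s w < +oo)%E.

Lemma gagliardo_ge0 w : (0 <= gagliardo s w)%E.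
Proof.
by apply: integral_ge0 => x _; apply: integral_ge0 => y _; rewrite lee_fin; exact: energy_density_ge0.
Qed.

Lemma energy_ge0 w : 0 <= energy w.
Proof. by rewrite fine_ge0// gagliardo_ge0. Qed.

Lemma energyK w : finite_energy w -> (energy w)%:E = gagliardo s w.
Proof. by case=> _ wE; rewrite fineK// ge0_fin_numE ?gagliardo_ge0. Qed.

Lemma integrable_energy w : finite_energy w ->
  mu2.-integrable setT (fun z => (energy_density R s w z.1 z.2)%:E).
Proof.
move=> [mw wE]; apply/integrableP; split.
  by apply/measurable_EFinP; exact: measurable_energy_density.
rewrite gagliardoE// in wE; apply: le_lt_trans wE.
rewrite le_eqVlt; apply/orP; left; apply/eqP; apply: eq_integral => z _.
by rewrite /= ger0_norm// energy_density_ge0.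
Qed.

Lemma measurable_bform (rho : R * R -> R) (u v : R -> R) : measurable_fun setT rho -> measurable_fun setT u ->
  measurable_fun setT v ->
  measurable_fun setT (fun z : R * R =>
    rho z * ((u z.1 - u z.2) * (v z.1 - v z.2)) * kern s z.1 z.2).
Proof. by move=> mr mu mv; meas. Qed.

Lemma integrable_bform (rho : R * R -> R) M (u v : R -> R) : measurable_fun setT rho -> (forall z, `|rho z| <= M) ->
  finite_energy u -> finite_energy v ->
  mu2.-integrable setT (fun z => (rho z * ((u z.1 - u z.2) * (v z.1 - v z.2)) * kern s z.1 z.2)%:E).
Proof.
move=> mr rM fu fv; have M0 : 0 <= M by apply: le_trans (rM (0, 0)).
apply: (@le_integrable _ _ _ mu2 setT _ _ (fun z => (M%:E *
   ((energy_density R s u z.1 z.2)%:E + (energy_density R s v z.1 z.2)%:E))%E)) => //.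
- have [mu uE] := fu; have [mv vE] := fv.
  by apply/measurable_EFinP; exact: measurable_bform.
- move=> z _; rewrite -EFinD -EFinM /= lee_fin.
  have k0 := kern_ge0 R s z.1 z.2.
  rewrite !normrM (ger0_norm k0) (ger0_norm M0) -mulrA.
  apply: ler_pM => //; first by nneg.
  rewrite [leRHS]ger0_norm; last by apply: addr_ge0; exact: energy_density_ge0.
  rewrite /energy_density -mulrDl ler_wpM2r//.
  rewrite -(real_normK (num_real (u z.1 - u z.2))) -(real_normK (num_real (v z.1 - v z.2))).
  move: `|_| `|_| (normr_ge0 (u z.1 - u z.2)) (normr_ge0 (v z.1 - v z.2)) => p q p0 q0.
  have : 0 <= (p - q) ^+ 2 by exact: sqr_ge0.
  have : 0 <= p ^+ 2 + q ^+ 2 by rewrite addr_ge0 ?sqr_ge0.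
  by rewrite sqrrB; lra.
- apply: integrableZl => //; apply: integrableD => //; exact: integrable_energy.
Qed.

Lemma bformC rho u v : bform rho u v = bform rho v u.
Proof. by apply: eq_Rintegral => z _; rewrite (mulrC (u _ - _)). Qed.

Lemma bform_energy w : finite_energy w -> bform (fun=> 1) w w = energy w.
Proof.
move=> [mw wE]; rewrite /energy gagliardoE//; congr fine.
by apply: eq_integral => z _; rewrite mul1r -expr2.
Qed.

Section BoundedWeight.
Variables (rho : R * R -> R) (M : R).
Hypotheses (mr : measurable_fun setT rho) (rM : forall z, `|rho z| <= M).

Lemma bform_linear (u v w : R -> R) c : finite_energy u -> finite_energy v -> finite_energy w ->
  bform rho (fun x => c * u x + v x) w = c * bform rho u w + bform rho v w.
Proof.
move=> fu fv fw.
have iu := integrable_bform _ _ _ _ mr rM fu fw.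
have iv := integrable_bform _ _ _ _ mr rM fv fw.
rewrite /bform -RintegralZl// -RintegralD//; last first.
  exact: (integrableZl measurableT c iu).
apply: eq_Rintegral => z _; ring.
Qed.

Lemma bform_le (rho' : R * R -> R) M' (w : R -> R) : measurable_fun setT rho' -> (forall z, `|rho' z| <= M') ->
  finite_energy w ->
  (forall z, rho z * (w z.1 - w z.2) ^+ 2 <= rho' z * (w z.1 - w z.2) ^+ 2) ->
  bform rho w w <= bform rho' w w.
Proof.
move=> mr' rM' fw H; apply: le_Rintegral; rewrite ?/=.
- by [].
- exact: (integrable_bform _ _ _ _ mr rM fw fw).
- exact: (integrable_bform _ _ _ _ mr' rM' fw fw).
- by move=> z _; rewrite -!expr2 ler_wpM2r ?kern_ge0.
Qed.

Lemma bform_ge0 w : (forall z, 0 <= rho z) -> 0 <= bform rho w w.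
Proof.
by move=> r0; apply: Rintegral_ge0 => z _; rewrite -expr2; nneg.
Qed.

End BoundedWeight.

Lemma bform_scale (rho : R * R -> R) c (u v : R -> R) M : measurable_fun setT rho -> (forall z, `|rho z| <= M) ->
  finite_energy u -> finite_energy v ->
  bform (fun z => c * rho z) u v = c * bform rho u v.
Proof.
move=> mr rM fu fv; rewrite /bform -RintegralZl//; last exact: (integrable_bform _ _ _ _ mr rM fu fv).
by apply: eq_Rintegral => z _; rewrite !mulrA.
Qed.

Lemma bform_weightD (rho rho' : R * R -> R) (u v : R -> R) M M' : measurable_fun setT rho -> (forall z, `|rho z| <= M) ->
  measurable_fun setT rho' -> (forall z, `|rho' z| <= M') ->
  finite_energy u -> finite_energy v ->
  bform (fun z => rho z + rho' z) u v = bform rho u v + bform rho' u v.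
Proof.
move=> mr rM mr' rM' fu fv; rewrite /bform -RintegralD//; last 2 first.
- exact: (integrable_bform _ _ _ _ mr rM fu fv).
- exact: (integrable_bform _ _ _ _ mr' rM' fu fv).
by apply: eq_Rintegral => z _; ring.
Qed.

(** Fubini's theorem. The inner [Rintegral] applies [fine], which is faithful only where the section
    in [x] is integrable, that is, almost everywhere. *)
Lemma iterated_Rintegral (F : R -> R -> R) :
  mu2.-integrable setT (fun z => (F z.1 z.2)%:E) ->
  Rintegral leb setT (fun x => Rintegral leb setT (F x)) =
  Rintegral mu2 setT (fun z => F z.1 z.2).
Proof.
move=> iF; rewrite /Rintegral -(integral12_prod_meas1 iF); congr fine.
have mF : measurable_fun setT (fubini_F leb (fun z : measurableTypeR R * measurableTypeR R => (F z.1 z.2)%:E)).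
  exact: (measurable_fubini_F iF).
apply: ae_eq_integral => //.
  by apply/measurable_EFinP; apply: (measurableT_comp _ mF); exact: fine_measurable.
have := ae_integrable1 iF; apply: filterS => x /= ix _.
by rewrite fineK//; exact: integrable_fin_num.
Qed.

End BilinearForms.

(** * Linearity and completeness of the energy space *)

Section SpaceHts.
Variable R : realType.
Notation leb := (@lebesgue_measure R).
Notation mu2 := (leb \x leb)%E.
Variable s : R.
Hypothesis s12 : 2^-1 < s.

Lemma Hts_finite_energy w : Hts s w -> finite_energy R s w.
Proof. by case=> cw [_ wE]; split => //; exact: continuous_measurable_fun. Qed.

Lemma energy_density_linear_le u v c x y :
  energy_density R s (fun x => c * u x + v x) x y <=
  2 * c ^+ 2 * energy_density R s u x y + 2 * energy_density R s v x y.
Proof.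
rewrite /energy_density !mulrA -mulrDl ler_wpM2r ?kern_ge0//.
have : 0 <= (c * (u x - u y) - (v x - v y)) ^+ 2 by exact: sqr_ge0.
by rewrite -subr_ge0; congr (_ <= _); ring.
Qed.

Lemma finite_energy_linear u v c : finite_energy R s u -> finite_energy R s v ->
  finite_energy R s (fun x => c * u x + v x).
Proof.
move=> [mu uE] [mv vE]; have mw : measurable_fun setT (fun x => c * u x + v x) by meas.
split; first exact: mw.
rewrite (gagliardoE R s _ mu) in uE; rewrite (gagliardoE R s _ mv) in vE; rewrite (gagliardoE R s _ mw).
have mdu := measurable_energy_density R s u mu.
have mdv := measurable_energy_density R s v mv.
have c0 : 0 <= 2 * c ^+ 2 by rewrite mulr_ge0 ?sqr_ge0.
apply: (@le_lt_trans _ _ (\int[mu2]_z (2 * c ^+ 2 * energy_density R s u z.1 z.2 +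
   2 * energy_density R s v z.1 z.2)%:E)%E).
  apply: ge0_le_integral_EFin.
  - by move=> z; exact: energy_density_ge0.
  - exact: measurable_energy_density.
  - by apply: measurable_funD; apply: measurable_funM.
  - by move=> z; exact: energy_density_linear_le.
rewrite ge0_integralD_EFin; first last.
- by apply: measurable_funM.
- by apply: measurable_funM.
- by move=> z; apply: mulr_ge0 => //; exact: energy_density_ge0.
- by move=> z; apply: mulr_ge0 => //; exact: energy_density_ge0.
rewrite !ge0_integralZ_EFin//; first last.
- by move=> z; exact: energy_density_ge0.
- by move=> z; exact: energy_density_ge0.
have F0 w : (0 <= \int[mu2]_z (energy_density R s w z.1 z.2)%:E)%E.
  by apply: integral_ge0 => z _; rewrite lee_fin energy_density_ge0.
by rewrite lte_add_pinfty// lte_mul_pinfty// lee_fin.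
Qed.

Lemma Hts_linear u v c : Hts s u -> Hts s v -> Hts s (fun x => c * u x + v x).
Proof.
move=> Hu Hv; have [cu [u0 uE]] := Hu; have [cv [v0 vE]] := Hv.
split; last split.
- by move=> x; apply: cvgD; [apply: cvgM; [exact: cvg_cst|exact: cu]|exact: cv].
- by move=> x Ix; rewrite u0// v0// mulr0 addr0.
- by have [] := finite_energy_linear u v c (Hts_finite_energy _ Hu) (Hts_finite_energy _ Hv).
Qed.

Definition supC : R := 2 `^ (2 * s) * hconst R s.

Lemma supC_ge0 : 0 <= supC.
Proof. by rewrite /supC mulr_ge0 ?powR_ge0 ?hconst_ge0. Qed.

Lemma sup_le_energy w p : Hts s w -> w p ^+ 2 <= supC * energy R s w.
Proof.
move=> Hw; have [cw [w0 wE]] := Hw.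
by rewrite -lee_fin [X in (_ <= X)%E]EFinM energyK; [exact: sup_le_gagliardo|exact: Hts_finite_energy].
Qed.

Lemma energy_eq0 w : Hts s w -> energy R s w = 0 -> w = (fun=> 0).
Proof.
move=> Hw E0; apply/funext => p; apply/eqP; rewrite -sqrf_eq0 eq_le sqr_ge0 andbT.
by have := sup_le_energy w p Hw; rewrite E0 mulr0.
Qed.

(** The energy dominates the supremum norm, so the sequence converges uniformly; the limit is
    continuous and vanishes outside I, and Fatou's lemma carries the Cauchy estimate over to it. *)
Lemma energy_complete (u_ : nat -> R -> R) : (forall n, Hts s (u_ n)) ->
  (forall e, 0 < e -> exists N, forall m n, (N <= m)%N -> (N <= n)%N ->
     energy R s (fun x => -1 * u_ n x + u_ m x) <= e) ->
  exists2 u, Hts s u & forall e, 0 < e -> exists N, forall n, (N <= n)%N ->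
     energy R s (fun x => -1 * u_ n x + u x) <= e.
Proof.
move=> Hu Cu.
have Hd m n : Hts s (fun x => -1 * u_ n x + u_ m x) by exact: Hts_linear.
have Cp e : 0 < e -> exists N, forall m n x, (N <= m)%N -> (N <= n)%N -> `|u_ m x - u_ n x| <= e.
  move=> e0; have c1 : 0 < supC + 1 by rewrite ltr_wpDl// supC_ge0.
  have [|N HN] := Cu (e ^+ 2 / (supC + 1)); first by rewrite divr_gt0// exprn_gt0.
  exists N => m n x Nm Nn.
  rewrite -(@ler_pXn2r _ 2)// ?nnegrE ?(ltW e0)// real_normK ?num_real//.
  rewrite (_ : u_ m x - u_ n x = -1 * u_ n x + u_ m x); last by ring.
  apply: (le_trans (sup_le_energy (fun x => -1 * u_ n x + u_ m x) x (Hd m n))).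
  apply: (@le_trans _ _ ((supC + 1) * (e ^+ 2 / (supC + 1)))).
    by apply: ler_pM; rewrite ?supC_ge0 ?energy_ge0 ?lerDl//; exact: HN.
  by rewrite mulrCA divff ?mulr1// gt_eqF.
have cvx x : cvgn (fun n => u_ n x).
  apply/cauchy_cvgP; apply: cauchy_exP => e e0.
  have [|N HN] := Cp (e / 2); first by rewrite divr_gt0.
  exists (u_ N x); exists N => // n /= Nn.
  rewrite /ball /= (le_lt_trans (HN _ _ _ (leqnn N) Nn))//.
  by rewrite ltr_pdivrMr// ltr_pMr// ltr1n.
pose u x := limn (fun n => u_ n x).
have ucvg x : u_ n x @[n --> \oo] --> u x by exact: cvx.
have Cu' e : 0 < e -> exists N, forall n x, (N <= n)%N -> `|u x - u_ n x| <= e.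
  move=> e0; have [N HN] := Cp e e0; exists N => n x Nn.
  have H : `|u_ m x - u_ n x| @[m --> \oo] --> `|u x - u_ n x|.
    by apply: cvg_norm; apply: cvgB; [exact: ucvg|exact: cvg_cst].
  rewrite -(cvg_lim _ H)//; apply: limr_le; first exact: (cvgP _ H).
  by exists N => // m /= Nm; exact: HN.
have cu : continuous u.
  move=> x; apply/cvgrPdist_lt => e e0.
  have e4 : 0 < e / 4 by rewrite divr_gt0.
  have [N HN] := Cu' _ e4; have [cN _] := Hu N.
  have /cvgrPdist_lt /(_ _ e4) := cN x; apply: filterS => y xy.
  have := HN N x (leqnn N); have := HN N y (leqnn N).
  move: xy; rewrite !ltr_norml !ler_norml => /andP[a1 a2] /andP[b1 b2] /andP[c1 c2].
  by apply/andP; split; lra.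
have u0 x : ~ I_ x -> u x = 0.
  move=> Ix; apply/cvg_lim => //; rewrite (_ : (fun n => _) = (fun=> 0)); first exact: cvg_cst.
  by apply/funext => n; have [_ [-> //]] := Hu n.
have mu : measurable_fun setT u by exact: continuous_measurable_fun.
(* The index is shifted by [N], so that the Cauchy bound holds for every term of the sequence given
   to Fatou's lemma. *)
have key e N n : (forall m, (N <= m)%N -> energy R s (fun x => -1 * u_ n x + u_ m x) <= e) ->
    (gagliardo s (fun x => -1 * u_ n x + u x)%R <= e%:E)%E.
  move=> HN; have [mn _] := Hts_finite_energy _ (Hu n).
  rewrite gagliardoE; last by meas.
  apply: (fatou_bound _ _ _ _ (fun m (z : measurableTypeR R * measurableTypeR R) => energy_density R s (fun x => -1 * u_ n x + u_ (m + N)%N x) z.1 z.2)).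
  - by move=> m z; exact: energy_density_ge0.
  - by move=> m; apply: measurable_energy_density; have [] := Hts_finite_energy _ (Hd (m + N)%N n).
  - move=> z; rewrite /energy_density; apply: cvgMr_tmp; rewrite expr2.
    under eq_fun do rewrite expr2.
    have H y : -1 * u_ n y + u_ (m + N)%N y @[m --> \oo] --> -1 * u_ n y + u y.
      by apply: cvgD; [exact: cvg_cst|rewrite (cvg_shiftn N (u_ ^~ y)); exact: ucvg].
    by apply: cvgM; apply: cvgB; exact: H.
  - move=> m; have [mm _] := Hts_finite_energy _ (Hd (m + N)%N n).
    rewrite -gagliardoE// -energyK; last exact/Hts_finite_energy/Hd.
    by rewrite lee_fin HN// leq_addl.
have uE : (gagliardo s u < +oo)%E.
  have [N HN] := Cu 1 ltr01.
  have F1 : finite_energy R s (fun x => -1 * u_ N x + u x).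
    split; first by have [mN _] := Hts_finite_energy _ (Hu N); meas.
    by apply: (le_lt_trans (key 1 N N _)); [move=> m Nm; exact: HN|exact: ltry].
  have := finite_energy_linear _ _ 1 (Hts_finite_energy _ (Hu N)) F1.
  rewrite (_ : (fun x => _) = u); first by case.
  by apply/funext => x; ring.
exists u; first by [].
move=> e e0; have [N HN] := Cu e e0; exists N => n Nn.
have fE : finite_energy R s (fun x => -1 * u_ n x + u x).
  by apply: finite_energy_linear; [exact/Hts_finite_energy|split].
by rewrite -lee_fin energyK//; apply: (key e N n) => m Nm; exact: HN.
Qed.

End SpaceHts.

(** * The forms with coefficients sigma and |sigma|, and the flip at b *)

Section TransmissionForm.
Variable R : realType.
Notation leb := (@lebesgue_measure R).
Notation mu2 := (leb \x leb)%E.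
Variables (s b s1 s2 : R).
Hypotheses (s12 : 2^-1 < s) (b0 : 0 < b) (b1 : b < 1) (s1_gt0 : 0 < s1) (s2_lt0 : s2 < 0).

Definition in_I (x : R) : bool := (0 < x) && (x < 1).
Definition in_I1 (x : R) : bool := (0 < x) && (x < b).
Definition in_I2 (x : R) : bool := (b < x) && (x < 1).

Definition in_sigma1 (x y : R) : bool :=
  (in_I1 x && (in_I1 y || ~~ in_I y)) || (in_I1 y && ~~ in_I x).
Definition in_sigma2 (x y : R) : bool :=
  (in_I2 x && (in_I2 y || ~~ in_I y)) || (in_I2 y && ~~ in_I x).

(** [rho1] and [rho2] are the positive and negative parts of the coefficient with [s3 = 0]; the
    guard in [rho2] copies the order of the tests in [sigma]. *)
Definition rho1 (z : R * R) : R := s1 * (in_sigma1 z.1 z.2)%:R.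
Definition rho2 (z : R * R) : R := - s2 * (~~ in_sigma1 z.1 z.2 && in_sigma2 z.1 z.2)%:R.

Lemma sigma_split x y : sigma b s1 s2 0 x y = rho1 (x, y) - rho2 (x, y).
Proof.
have A1 z t : `[< I1 b z /\ (I1 b t \/ ~ I_ t) >] = in_I1 z && (in_I1 t || ~~ in_I t).
  apply/asboolP/andP => -[h1 h2]; split => //.
    by case: h2 => [h2|/negP h2]; apply/orP; [left|right].
  by case/orP: h2 => [h2|/negP h2]; [left|right].
have A2 z t : `[< I2 b z /\ (I2 b t \/ ~ I_ t) >] = in_I2 z && (in_I2 t || ~~ in_I t).
  apply/asboolP/andP => -[h1 h2]; split => //.
    by case: h2 => [h2|/negP h2]; apply/orP; [left|right].
  by case/orP: h2 => [h2|/negP h2]; [left|right].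
have B1 z t : `[< I1 b z /\ ~ I_ t >] = in_I1 z && ~~ in_I t.
  by apply/asboolP/andP => -[h1 h2]; split => //; apply/negP.
have B2 z t : `[< I2 b z /\ ~ I_ t >] = in_I2 z && ~~ in_I t.
  by apply/asboolP/andP => -[h1 h2]; split => //; apply/negP.
rewrite /sigma A1 A2 B1 B2 -/(in_sigma1 x y) -/(in_sigma2 x y) /rho1 /rho2 /=.
case: (in_sigma1 x y); case: (in_sigma2 x y) => /=; rewrite ?if_same; ring.
Qed.

Lemma measurable_in_sigma :
  measurable_fun setT (fun z : R * R => in_sigma1 z.1 z.2) /\
  measurable_fun setT (fun z : R * R => in_sigma2 z.1 z.2).
Proof.
have m11 : measurable_fun setT (fun z : R * R => in_I1 z.1) by rewrite /in_I1; meas.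
have m12 : measurable_fun setT (fun z : R * R => in_I1 z.2) by rewrite /in_I1; meas.
have m21 : measurable_fun setT (fun z : R * R => in_I2 z.1) by rewrite /in_I2; meas.
have m22 : measurable_fun setT (fun z : R * R => in_I2 z.2) by rewrite /in_I2; meas.
have m01 : measurable_fun setT (fun z : R * R => in_I z.1) by rewrite /in_I; meas.
have m02 : measurable_fun setT (fun z : R * R => in_I z.2) by rewrite /in_I; meas.
split; rewrite /in_sigma1 /in_sigma2; apply: measurable_or; apply: measurable_and => //.
- by apply: measurable_or => //; exact: measurable_neg.
- exact: measurable_neg.
- by apply: measurable_or => //; exact: measurable_neg.
- exact: measurable_neg.
Qed.

Lemma measurable_rho1 : measurable_fun setT rho1.
Proof.
have [m1 _] := measurable_in_sigma; rewrite /rho1.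
by apply: measurable_funM => //; exact: measurable_fun_bool_real.
Qed.

Lemma measurable_rho2 : measurable_fun setT rho2.
Proof.
have [m1 m2] := measurable_in_sigma; rewrite /rho2.
apply: measurable_funM => //; apply: measurable_fun_bool_real.
by apply: measurable_and => //; exact: measurable_neg.
Qed.

Definition sigma_bound : R := s1 - s2.

Lemma rho1_ge0 z : 0 <= rho1 z. Proof. by rewrite /rho1 mulr_ge0// ltW. Qed.

Lemma rho2_ge0 z : 0 <= rho2 z. Proof. by rewrite /rho2 mulr_ge0// oppr_ge0 ltW. Qed.

Lemma rhoD_le z : rho1 z + rho2 z <= sigma_bound.
Proof.
rewrite /rho1 /rho2 /sigma_bound; move: s1_gt0 s2_lt0.
by case: (in_sigma1 _ _); case: (in_sigma2 _ _) => /=; lra.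
Qed.

Lemma rho1_norm_le z : `|rho1 z| <= sigma_bound.
Proof. by rewrite ger0_norm ?rho1_ge0//; apply: le_trans (rhoD_le z); rewrite lerDl rho2_ge0. Qed.

Lemma rho2_norm_le z : `|rho2 z| <= sigma_bound.
Proof. by rewrite ger0_norm ?rho2_ge0//; apply: le_trans (rhoD_le z); rewrite lerDr rho1_ge0. Qed.

(** The fourth case is the point [x = b], which lies in I but in neither half. *)
Lemma region_cases x :
  [\/ [/\ in_I1 x = true, in_I2 x = false, in_I x = true, (b < x) = false & (x < b) = true],
      [/\ in_I1 x = false, in_I2 x = true, in_I x = true, (b < x) = true & (x < b) = false],
      [/\ in_I1 x = false, in_I2 x = false & in_I x = false] |
      [/\ in_I1 x = false, in_I2 x = false, in_I x = true, (b < x) = false & (x < b) = false]].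
Proof.
rewrite /in_I1 /in_I2 /in_I.
have [x0|x0] := ltP 0 x; last first.
  by apply: Or43; split => //=; apply/negbTE; rewrite negb_and -leNgt (le_trans x0) ?ltW.
have [x1|x1] := ltP x 1; last first.
  apply: Or43; split; rewrite ?andbF//=.
  by apply/negbTE; rewrite -leNgt (le_trans (ltW b1)).
by have [xb|xb|xb] := ltgtP x b; [apply: Or41|apply: Or42|apply: Or44].
Qed.

Definition flip (w : R -> R) (x : R) : R := if b < x then - w x else w x.

Definition vanish (w : R -> R) : Prop := forall x, ~ I_ x -> w x = 0.

Lemma vanishE w x : vanish w -> in_I x = false -> w x = 0.
Proof. by move=> w0 Ix; apply: w0; apply/negP; rewrite -[_ && _]/(in_I x) Ix. Qed.

(** In a pair weighted by [rho2] both points lie in the right half or one of them is outside I,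
    where [w] is 0; so [flip] changes the sign of the increment and cancels that of [- rho2]. Pairs
    across [b] have weight 0 on both sides. *)
Lemma rho_flip (u w : R -> R) x y : vanish w ->
  (rho1 (x, y) - rho2 (x, y)) * ((u x - u y) * (flip w x - flip w y)) =
  (rho1 (x, y) + rho2 (x, y)) * ((u x - u y) * (w x - w y)).
Proof.
move=> w0; rewrite /rho1 /rho2 /in_sigma1 /in_sigma2 /=.
have fx : in_I x = false -> w x = 0 /\ flip w x = 0.
  by move=> Ix; rewrite /flip (vanishE _ _ w0 Ix) oppr0 if_same.
have fy : in_I y = false -> w y = 0 /\ flip w y = 0.
  by move=> Iy; rewrite /flip (vanishE _ _ w0 Iy) oppr0 if_same.
have gx1 : (b < x) = false -> flip w x = w x by rewrite /flip => ->.
have gx2 : (b < x) = true -> flip w x = - w x by rewrite /flip => ->.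
have gy1 : (b < y) = false -> flip w y = w y by rewrite /flip => ->.
have gy2 : (b < y) = true -> flip w y = - w y by rewrite /flip => ->.
have cx : [\/ [/\ in_I1 x = true, in_I2 x = false, in_I x = true & flip w x = w x],
  [/\ in_I1 x = false, in_I2 x = true, in_I x = true & flip w x = - w x],
  [/\ in_I1 x = false, in_I2 x = false, in_I x = false & flip w x = 0 /\ w x = 0] |
  [/\ in_I1 x = false, in_I2 x = false & in_I x = true]].
  have [[? ? ? ? ?]|[? ? ? ? ?]|[? ? Ix]|[? ? ? ? ?]] := region_cases x.
  - by apply: Or41; split => //; exact: gx1.
  - by apply: Or42; split => //; exact: gx2.
  - by apply: Or43; have [? ?] := fx Ix.
  - by apply: Or44.
have cy : [\/ [/\ in_I1 y = true, in_I2 y = false, in_I y = true & flip w y = w y],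
  [/\ in_I1 y = false, in_I2 y = true, in_I y = true & flip w y = - w y],
  [/\ in_I1 y = false, in_I2 y = false, in_I y = false & flip w y = 0 /\ w y = 0] |
  [/\ in_I1 y = false, in_I2 y = false & in_I y = true]].
  have [[? ? ? ? ?]|[? ? ? ? ?]|[? ? Iy]|[? ? ? ? ?]] := region_cases y.
  - by apply: Or41; split => //; exact: gy1.
  - by apply: Or42; split => //; exact: gy2.
  - by apply: Or43; have [? ?] := fy Iy.
  - by apply: Or44.
by case: cx => [[-> -> -> fxE]|[-> -> -> fxE]|[-> -> -> [fxE wxE]]|[-> -> ->]];
   case: cy => [[-> -> -> fyE]|[-> -> -> fyE]|[-> -> -> [fyE wyE]]|[-> -> ->]] /=;
   rewrite ?fxE ?fyE ?wxE ?wyE; ring.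
Qed.

Definition side_weight (z : R * R) : R :=
  side R 1 (z.1 - b) * side R 1 (z.2 - b) + side R (-1) (z.1 - b) * side R (-1) (z.2 - b).

(** Two points strictly on one side of [b] either both lie outside I, where the increment vanishes,
    or form a pair of weight [s1] or [- s2]. *)
Lemma side_weight_le (w : R -> R) x y m : vanish w -> 0 <= m -> m <= s1 -> m <= - s2 ->
  m * side_weight (x, y) * (w x - w y) ^+ 2 <= (rho1 (x, y) + rho2 (x, y)) * (w x - w y) ^+ 2.
Proof.
move=> w0 m0 m1 m2; rewrite /side_weight /side /= !mul1r !mulN1r !oppr_gt0 !subr_gt0 !subr_lt0.
rewrite /rho1 /rho2 /in_sigma1 /in_sigma2 /=; move: s1_gt0 s2_lt0 => s1p s2n.
have [[-> -> -> -> ->]|[-> -> -> -> ->]|[ex1 ex2 Ix]|[-> -> -> -> ->]] := region_cases x;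
have [[-> -> -> -> ->]|[-> -> -> -> ->]|[ey1 ey2 Iy]|[-> -> -> -> ->]] := region_cases y;
  try (rewrite (vanishE _ _ w0 Ix) (vanishE _ _ w0 Iy) subrr expr0n /= !mulr0; exact: lexx);
  apply: ler_wpM2r; (try exact: sqr_ge0); rewrite ?ex1 ?ex2 ?Ix ?ey1 ?ey2 ?Iy /=;
  try (case: (b < x); case: (x < b) => /=); try (case: (b < y); case: (y < b) => /=);
  rewrite /= ?(mul0r, mulr0, mul1r, mulr1, addr0, add0r, oppr0);
  first [exact: lexx | exact: m1 | exact: m2 | exact: ltW | lra].
Qed.

Lemma measurable_side_weight : measurable_fun setT side_weight.
Proof. by rewrite /side_weight /side; meas. Qed.

Lemma side_weight_norm_le z : `|side_weight z| <= 2.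
Proof.
rewrite /side_weight /side; do 4 case: (0 < _) => /=;
  rewrite ?(mul0r, mulr0, mul1r, addr0, add0r, normr0, normr1)// ?ler1n//.
by rewrite ger0_norm.
Qed.

Definition sform (u v : R -> R) : R := bform R s (fun z => rho1 z + rho2 z) u v.

Lemma measurable_rhoD : measurable_fun setT (fun z => rho1 z + rho2 z).
Proof. by apply: measurable_funD; [exact: measurable_rho1|exact: measurable_rho2]. Qed.

Lemma rhoD_norm_le z : `|rho1 z + rho2 z| <= sigma_bound.
Proof. by rewrite ger0_norm ?addr_ge0 ?rho1_ge0 ?rho2_ge0// rhoD_le. Qed.

Lemma sigma_bound_ge0 : 0 <= sigma_bound.
Proof. by rewrite (le_trans (normr_ge0 _) (rhoD_norm_le (0, 0))). Qed.

Lemma bform_le_energy (rho : R * R -> R) w : measurable_fun setT rho ->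
  (forall z, `|rho z| <= sigma_bound) -> finite_energy R s w ->
  bform R s rho w w <= sigma_bound * energy R s w.
Proof.
move=> mr rM fw; have m1 : measurable_fun setT (fun _ : R * R => 1 : R) by exact: measurable_cst.
rewrite -bform_energy// -(bform_scale R s (fun=> 1) sigma_bound w w 1)//; last by move=> z; rewrite normr1.
apply: (bform_le R s rho sigma_bound mr rM _ (sigma_bound * 1)) => //.
- by move=> z; rewrite normrM normr1 ger0_norm// sigma_bound_ge0.
- by move=> z; rewrite mulr1 ler_wpM2r ?sqr_ge0// (le_trans (ler_norm _)).
Qed.

Lemma sform_le_energy w : finite_energy R s w -> sform w w <= sigma_bound * energy R s w.
Proof. by move=> fw; apply: bform_le_energy => //; [exact: measurable_rhoD|exact: rhoD_norm_le]. Qed.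

Definition coerc : R := gconst R s / Num.min s1 (- s2).

Lemma min_sigma_gt0 : 0 < Num.min s1 (- s2).
Proof. by rewrite lt_min s1_gt0 oppr_gt0. Qed.

Lemma coerc_ge0 : 0 <= coerc.
Proof. by rewrite divr_ge0 ?gconst_ge0// ltW// min_sigma_gt0. Qed.

Lemma side_energyD w : Hts s w ->
  (side_energy R s 1 b w + side_energy R s (-1) b w = (bform R s side_weight w w)%:E)%E.
Proof.
move=> Hw; have fw := Hts_finite_energy R s w Hw; have [mw _] := fw.
have ib := integrable_bform R s _ _ _ _ measurable_side_weight side_weight_norm_le fw fw.
rewrite /bform /Rintegral fineK; last exact: integrable_fin_num.
rewrite /side_energy -ge0_integralD_EFin; first last.
- exact: measurable_side_energy.
- exact: measurable_side_energy.
- by move=> z; rewrite /energy_density; nneg.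
- by move=> z; rewrite /energy_density; nneg.
apply: eq_integral => z _; rewrite /side_weight /energy_density; congr EFin; ring.
Qed.

(** Pairs across [b] carry no weight in [S]; the gluing estimate recovers their energy from the
    one-sided energies, on which the weight is at least [min s1 (- s2)] wherever the increment of
    [w] is nonzero. *)
Lemma sform_coercive w : Hts s w -> energy R s w <= coerc * sform w w.
Proof.
move=> Hw; have fw := Hts_finite_energy R s w Hw; have [cw [w0 wE]] := Hw.
have := gagliardo_le_sides R s s12 b w cw.
rewrite side_energyD// -energyK// -EFinM lee_fin => /le_trans; apply.
rewrite /coerc -mulrA ler_wpM2l ?gconst_ge0// ler_pdivlMl ?min_sigma_gt0//.
rewrite -(bform_scale R s _ _ w w 2)//; [|exact: measurable_side_weight|exact: side_weight_norm_le].
apply: (bform_le R s _ (Num.min s1 (- s2) * 2) _ _ _ sigma_bound) => //.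
- by apply: measurable_funM => //; exact: measurable_side_weight.
- move=> z; rewrite normrM (gtr0_norm min_sigma_gt0) ler_wpM2l ?(ltW min_sigma_gt0)//.
  exact: side_weight_norm_le.
- exact: measurable_rhoD.
- exact: rhoD_norm_le.
- move=> [x y]; apply: side_weight_le => //; first exact: ltW min_sigma_gt0.
    by rewrite ge_min lexx.
  by rewrite ge_min lexx orbT.
Qed.

Lemma side_energy_le sg w : measurable_fun setT w -> (side_energy R s sg b w <= gagliardo s w)%E.
Proof.
move=> mw; rewrite gagliardoE//; apply: ge0_le_integral_EFin.
- by move=> z; rewrite /energy_density; nneg.
- exact: measurable_side_energy.
- exact: measurable_energy_density.
- move=> z; rewrite /side; do 2 case: (0 < _); rewrite ?(mul1r, mul0r)//; exact: energy_density_ge0.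
Qed.

Lemma side_energy_flip sg w : sg = 1 \/ sg = -1 -> side_energy R s sg b (flip w) = side_energy R s sg b w.
Proof.
move=> sgE; apply: eq_integral => z _; congr EFin; rewrite /side /energy_density /flip.
have [x0|x0] := boolP (0 < sg * (z.1 - b)); last by rewrite !mul0r.
have [y0|y0] := boolP (0 < sg * (z.2 - b)); last by rewrite !mulr0 !mul0r.
case: sgE => sgE; move: x0 y0; rewrite sgE ?mul1r ?mulN1r ?oppr_gt0 ?subr_gt0 ?subr_lt0 => x0 y0.
  by rewrite x0 y0 -[in RHS]sqrrN opprB opprK addrC.
by rewrite !ltNge (ltW x0) (ltW y0).
Qed.

(** For [w b = 0], [flip w x = w (min x b) - w (max x b)], with minimum and maximum expressed by the
    absolute value. *)
Lemma continuous_flip w : continuous w -> w b = 0 -> continuous (flip w).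
Proof.
move=> cw wb.
have -> : flip w = (fun x => w ((x + b - `|x - b|) / 2) - w ((x + b + `|x - b|) / 2)).
  apply/funext => x; rewrite -minr_absE -maxr_absE /flip.
  have [xb|xb] := ltP b x; rewrite ?wb ?sub0r ?subr0//.
  all: rewrite ?wb ?sub0r ?subr0//.
have cn : continuous (fun x : R => `|x - b|).
  by move=> x; apply: cvg_norm; apply: cvgB; [exact: cvg_id|exact: cvg_cst].
have cp : continuous (fun x : R => x + b).
  by move=> x; apply: cvgD; [exact: cvg_id|exact: cvg_cst].
have c1 : continuous (fun x : R => (x + b - `|x - b|) / 2).
  by move=> x; apply: cvgMr_tmp; apply: cvgB; [exact: cp|exact: cn].
have c2 : continuous (fun x : R => (x + b + `|x - b|) / 2).
  by move=> x; apply: cvgMr_tmp; apply: cvgD; [exact: cp|exact: cn].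
by move=> x; apply: cvgB; [exact: (cvg_comp _ _ (c1 x) (cw _))|exact: (cvg_comp _ _ (c2 x) (cw _))].
Qed.

(** On either side of [b] the flip is a global sign, so the one-sided energies do not change. Gluing
    them costs [gconst], and each is at most the full energy, whence the 2. *)
Lemma flip_Hts w : Hts s w -> w b = 0 ->
  Hts s (flip w) /\ energy R s (flip w) <= 2 * gconst R s * energy R s w.
Proof.
move=> Hw wb; have [cw [w0 wE]] := Hw; have cf := continuous_flip w cw wb.
have fw := Hts_finite_energy R s w Hw; have [mw _] := fw.
have H : (gagliardo s (flip w) <= (2 * gconst R s * energy R s w)%:E)%E.
  apply: (le_trans (gagliardo_le_sides R s s12 b _ cf)).
  rewrite !side_energy_flip; [|by right|by left].
  rewrite -mulrA mulrCA [X in (_ <= X)%E]EFinM; apply: lee_wpmul2l; first by rewrite lee_fin gconst_ge0.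
  have -> : 2 * energy R s w = energy R s w + energy R s w by ring.
  by rewrite [X in (_ <= X)%E]EFinD energyK//; apply: leeD; exact: side_energy_le.
have Hf : Hts s (flip w).
  split; first exact: cf.
  split; last by apply: (le_lt_trans H); exact: ltry.
  by move=> x Ix; rewrite /flip w0// oppr0 if_same.
split; first exact: Hf.
by rewrite -lee_fin energyK; [exact: H|exact: Hts_finite_energy].
Qed.

Definition tform (u v : R -> R) : R := bform R s (fun z => rho1 z - rho2 z) u v.

Lemma measurable_rhoB : measurable_fun setT (fun z => rho1 z - rho2 z).
Proof. by apply: measurable_funB; [exact: measurable_rho1|exact: measurable_rho2]. Qed.

Lemma rhoB_norm_le z : `|rho1 z - rho2 z| <= sigma_bound.
Proof.
have := rho1_ge0 z; have := rho2_ge0 z; have := rhoD_le z => h1 h2 h3.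
by rewrite ler_norml; apply/andP; split; lra.
Qed.

Lemma aformE u v : Hts s u -> Hts s v -> aform s b s1 s2 0 u v = Cs s / 2 * tform u v.
Proof.
move=> Hu Hv; have fu := Hts_finite_energy R s u Hu; have fv := Hts_finite_energy R s v Hv.
rewrite /aform; congr (_ * _).
have ib := integrable_bform R s _ _ _ _ measurable_rhoB rhoB_norm_le fu fv.
rewrite /tform /bform -(iterated_Rintegral R (fun x y =>
  (rho1 (x, y) - rho2 (x, y)) * ((u x - u y) * (v x - v y)) * kern s x y)); last first.
  by apply: eq_integrable ib => //= -[x y] _.
apply: eq_Rintegral => x _; apply: eq_Rintegral => y _.
by rewrite sigma_split.
Qed.

Lemma tform_flip u w : Hts s w -> tform u (flip w) = sform u w.
Proof.
by move=> [_ [w0 _]]; apply: eq_Rintegral => -[x y] _; rewrite rho_flip.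
Qed.

(** The coefficient changes sign, so Cauchy-Schwarz is applied to the nonnegative weights [rho1] and
    [rho2] separately; [(p - q)^2 <= 2 p^2 + 2 q^2] yields the 4. *)
Lemma tform_bounded u v : Hts s u -> Hts s v ->
  tform u v ^+ 2 <= 4 * sigma_bound ^+ 2 * energy R s u * energy R s v.
Proof.
move=> Hu Hv; have fu := Hts_finite_energy R s u Hu; have fv := Hts_finite_energy R s v Hv.
have CS (rho : R * R -> R) : measurable_fun setT rho -> (forall z, `|rho z| <= sigma_bound) ->
    (forall z, 0 <= rho z) ->
    bform R s rho u v ^+ 2 <= sigma_bound ^+ 2 * energy R s u * energy R s v.
  move=> mr rM r0.
  have H := @form_cauchy_schwarz R R (finite_energy R s) (bform R s rho)
    (fun u v c => finite_energy_linear R s u v c) (bformC R s rho)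
    (fun u v w c => bform_linear R s rho _ mr rM u v w c) (fun u _ => bform_ge0 R s rho u r0) u v fu fv.
  apply: (le_trans H); rewrite expr2 -mulrA mulrACA.
  by apply: ler_pM; rewrite ?bform_ge0//; exact: bform_le_energy.
have C1 := CS rho1 measurable_rho1 rho1_norm_le rho1_ge0.
have C2 := CS rho2 measurable_rho2 rho2_norm_le rho2_ge0.
have -> : tform u v = bform R s rho1 u v - bform R s rho2 u v.
  rewrite /tform (bform_weightD R s rho1 (fun z => - rho2 z) u v sigma_bound sigma_bound)//.
  - congr (_ + _); rewrite -[RHS]mulN1r -(bform_scale R s rho2 (-1) u v sigma_bound)//.
    + by apply: eq_Rintegral => z _; rewrite mulN1r.
    + exact: measurable_rho2.
    + exact: rho2_norm_le.
  - exact: measurable_rho1.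
  - exact: rho1_norm_le.
  - by apply: measurable_funN; exact: measurable_rho2.
  - by move=> z; rewrite normrN rho2_norm_le.
move: C1 C2; move: (bform R s rho1 u v) (bform R s rho2 u v) => p q C1 C2.
have : 0 <= (p + q) ^+ 2 by exact: sqr_ge0.
rewrite sqrrD sqrrB.
have -> : 4 * sigma_bound ^+ 2 * energy R s u * energy R s v = 4 * (sigma_bound ^+ 2 * energy R s u * energy R s v) by rewrite !mulrA.
by move: C1 C2; move: (_ * energy R s v) => K C1 C2 h; lra.
Qed.

End TransmissionForm.

(** * Finiteness and positivity of Gamma, and C(s) > 0 *)

Section GammaPositivity.
Variable R : realType.
Notation leb := (@lebesgue_measure R).

Lemma integral_indicator_itv (a c : R) : a < c ->
  (\int[leb]_t (((a < t) && (t < c))%R%:R)%:E = (c - a)%:E)%E.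
Proof.
move=> ac.
have -> : (\int[leb]_t (((a < t) && (t < c))%R%:R)%:E = \int[leb]_t (\1_(`]a, c[%classic) t)%:E)%E.
  by apply: eq_integral => t _; rewrite indicE mem_setE in_itv.
rewrite integral_indic// setIT; apply: etrans (lebesgue_measure_itv `]a, c[) _.
by rewrite /= lte_fin ac -EFinB.
Qed.

Section PowerNearZero.
Variable z : R.
Hypothesis z0 : 0 < z.

Let h (n : nat) (t : R) : R := ((2^-1 ^+ n < t) && (t < 1))%R%:R * t `^ (z - 1).

(** Self-similarity: below 1/2 the power at [t] is [2^(1-z)] times the power at [2 t]; from 1/2 to 1
    it is at most [t^-1 <= 2]. *)
Let h_step n t : h n.+1 t <= 2 `^ (1 - z) * h n (2 * t + 0) + 2 * ((0 < t) && (t < 1))%R%:R.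
Proof.
rewrite /h addr0; have [/andP[t0 t1]|_] := boolP ((2^-1 ^+ n.+1 < t) && (t < 1)); last first.
  by rewrite mul0r; nneg.
have tp : 0 < t by apply: lt_trans t0; rewrite exprn_gt0// invr_gt0.
rewrite mul1r tp t1 mulr1; have [th|th] := ltP t 2^-1.
  have -> : 2^-1 ^+ n < 2 * t.
    by rewrite mulrC -ltr_pdivrMr// -exprSr.
  have -> : 2 * t < 1 by rewrite mulrC -ltr_pdivlMr// mul1r.
  rewrite mul1r powRM ?(ltW tp)// mulrA -powRD ?pnatr_eq0 ?implybT//.
  by rewrite (_ : 1 - z + (z - 1) = 0) ?powRr0 ?mul1r ?lerDl//; ring.
apply: (@le_trans _ _ 2); last by rewrite lerDr; nneg.
apply: (@le_trans _ _ (t `^ (-1))).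
  by apply: ger_powR; rewrite ?tp ?(ltW t1)// lerBrDr addNr ltW.
by rewrite powR_inv1 ?(ltW tp)// -[leRHS]invrK lef_pV2// posrE// invr_gt0.
Qed.

(** The self-similar bound integrates to [I_(n+1) <= 2^(-z) I_n + 2] for the truncations at [2^-n];
    [2 / (1 - r)] is the fixed point of this recursion. *)
Lemma integral_powR_near0 :
  (\int[leb]_t (((0 < t) && (t < 1))%R%:R * t `^ (z - 1))%:E < +oo)%E.
Proof.
pose r : R := 2 `^ (- z).
have r1 : r < 1.
  rewrite /r powRN invf_lt1 ?powR_gt0//.
  have := @gt0_ltr_powR R z z0 1 2; rewrite powR1 /=; apply; rewrite ?nnegrE//.
  by rewrite ltr1n.
have r0 : 0 <= r by exact: powR_ge0.
have h0 n t : 0 <= h n t by rewrite /h; nneg.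
have mh n : measurable_fun setT (h n) by rewrite /h; meas.
have I n : (\int[leb]_t (h n t)%:E <= (2 / (1 - r))%:E)%E.
  have c0 : 0 <= 2 / (1 - r) by rewrite divr_ge0// subr_ge0 ltW.
  elim: n => [|n IH].
    rewrite integral0_eq ?lee_fin// => t _; rewrite /h expr0.
    case: ltP => //= t1; last by rewrite mul0r.
    by rewrite ltNge (ltW t1)/= mul0r.
  have mh2 : measurable_fun setT (fun t : R => h n (2 * t + 0)).
    by apply: (measurableT_comp (mh n)); exact: measurable_affine.
  apply: (@le_trans _ _ (\int[leb]_t (2 `^ (1 - z) * h n (2 * t + 0) + 2 * ((0 < t) && (t < 1))%R%:R)%:E)%E).
    apply: ge0_le_integral_EFin; [exact: h0|exact: mh| |by move=> t; exact: h_step].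
    by apply: measurable_funD; [apply: measurable_funM|meas].
  rewrite ge0_integralD_EFin; first last.
  - by meas.
  - by apply: measurable_funM.
  - by move=> t; nneg.
  - by move=> t; nneg.
  rewrite !ge0_integralZ_EFin//; try (by meas); try (by nneg).
  have n2 : 2 != 0 :> R by rewrite pnatr_eq0.
  have A : (\int[leb]_t (h n (2 * t + 0))%:E = (`|2|^-1)%:E * \int[leb]_t (h n t)%:E)%E.
    apply: (@ge0_integral_affine R 2 0 (fun t => (h n t)%:E) n2); first exact/measurable_EFinP.
    by move=> t; rewrite lee_fin.
  rewrite A.
  rewrite integral_indicator_itv// subr0 mule1 muleA -EFinM normr_nat.
  have -> : 2 `^ (1 - z) * 2^-1 = r.
    rewrite /r (@powRD _ _ 1 (- z)); last by rewrite pnatr_eq0 implybT.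
    by rewrite powRr1//; field.
  apply: (@le_trans _ _ (r%:E * (2 / (1 - r))%R%:E + (2 : R)%R%:E)%E).
    by rewrite leeD2r// lee_wpmul2l.
  rewrite -EFinM -EFinD lee_fin le_eqVlt; apply/orP; left; apply/eqP; field.
  by rewrite gt_eqF// subr_gt0.
apply: (@le_lt_trans _ _ (2 / (1 - r))%:E); last exact: ltry.
apply: (fatou_bound _ (measurableTypeR R) _ leb h) => // t.
apply: cvgMr_tmp.
have [t0|t0] := ltP 0 t; last first.
  rewrite /=; apply: cvg_near_cst; apply: nearW => n.
  by rewrite ltNge (le_trans t0)// exprn_ge0// invr_ge0.
have e0 : 2^-1 ^+ n @[n --> \oo] --> (0 : R).
  by apply: cvg_expr; rewrite ger0_norm ?invr_ge0// invf_lt1// ltr1n.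
have /cvgrPdist_lt /(_ _ t0) := e0 => H.
apply: cvg_near_cst; apply: filterS H => n; rewrite sub0r normrN ger0_norm ?exprn_ge0 ?invr_ge0//.
by move=> ->.
Qed.

End PowerNearZero.

(** Since [fine] sends [+oo] to 0, positivity requires a finite integral as well as the lower bound
    on (1, 2). The range [z <= 2] covers both Gamma values in [Cs] and gives [t^(z-1) <= t] for
    [t >= 1]. *)
Lemma Gamma_gt0 (z : R) : 0 < z -> z <= 2 -> 0 < Gamma z.
Proof.
move=> z0 z2; rewrite /Gamma /Rintegral.
have -> : (\int[leb]_(t in [set t | (0 < t)%R]) (t `^ (z - 1) * expR (- t))%:E =
    \int[leb]_t ((0 < t)%R%:R * (t `^ (z - 1) * expR (- t)))%:E)%E.
  rewrite integral_mkcond; apply: eq_integral => t _; rewrite patchE.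
  by case: ifPn => [/set_mem /= ->|/negP]; rewrite ?mul1r// inE /= => /negP/negbTE ->; rewrite mul0r.
set f := fun t => _.
have mexp : measurable_fun setT (fun t : R => expR (- t)).
  apply: (measurableT_comp (continuous_measurable_fun (@continuous_expR R))).
  by apply: (@measurable_funN _ _ _ _ (fun t => t)); exact: measurable_id.
have f0 t : 0 <= (0 < t)%R%:R * (t `^ (z - 1) * expR (- t)).
  by rewrite mulr_ge0// mulr_ge0 ?powR_ge0 ?expR_ge0.
have mf : measurable_fun setT (fun t : R => (0 < t)%R%:R * (t `^ (z - 1) * expR (- t))).
  apply: measurable_funM; first by meas.
  by apply: measurable_funM; first by meas.
apply/fine_gt0/andP; split.
  apply: (@lt_le_trans _ _ (expR (- 2) / 2)%:E); first by rewrite lte_fin divr_gt0 ?expR_gt0.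
  rewrite -[leLHS]mule1 (_ : 1%E = (2 - 1)%:E :> \bar R); last by congr EFin; ring.
  rewrite -integral_indicator_itv ?ltr1n//.
  rewrite -ge0_integralZ_EFin; [|by rewrite divr_ge0 ?expR_ge0|by move=> t|by meas].
  apply: ge0_le_integral_EFin; [|by meas|exact: mf|].
    by move=> t; apply: mulr_ge0 => //; rewrite divr_ge0 ?expR_ge0.
  move=> t; have [/andP[t1 t2]|_] := boolP (_ && _); last by rewrite mulr0; exact: f0.
  have t0 : 0 < t by rewrite (lt_trans ltr01).
  rewrite mulr1 t0 mul1r mulrC; apply: ler_pM; rewrite ?invr_ge0 ?expR_ge0//.
    apply: (@le_trans _ _ (t `^ (-1))).
      by rewrite powR_inv1 ?(ltW t0)// lef_pV2 ?posrE// ltW.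
    by apply: ler_powR; rewrite ?(ltW t1)// lerBrDr addNr ltW.
  by rewrite ler_expR lerN2 ltW.
have mD : measurable_fun setT (fun t : R => (0 <= t)%R%:R * (oneDsqr t)^-1).
  apply: measurable_funM; first by meas.
  by apply: continuous_measurable_fun; exact: continuous_oneDsqrV.
have D0 (t : R) : 0 <= (0 <= t)%R%:R * (oneDsqr t)^-1.
  by rewrite mulr_ge0// invr_ge0 (le_trans ler01)// oneDsqr_ge1.
(* For [t >= 1], [t^(z-1) <= t] and [exp t >= (t/3)^3] bound the integrand by
   [27 / t^2 <= 54 / (1 + t^2)]. *)
apply: (@le_lt_trans _ _ (\int[leb]_t (((0 < t) && (t < 1))%R%:R * t `^ (z - 1) +
    54 * ((0 <= t)%R%:R * (oneDsqr t)^-1))%:E)%E).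
  apply: ge0_le_integral_EFin => //.
    by apply: measurable_funD; [meas|apply: measurable_funM].
  move=> t; have [t0|t0] := ltP 0 t; last by rewrite mul0r addr_ge0 ?mulr_ge0 ?powR_ge0.
  rewrite mul1r (ltW t0); have [t1|t1] := ltP t 1; rewrite /= !mul1r ?mul0r ?add0r.
    rewrite -[leLHS]addr0; apply: lerD; last by rewrite mulr_ge0// invr_ge0 (le_trans ler01)// oneDsqr_ge1.
    by rewrite ler_piMr ?powR_ge0// expR_le1 oppr_le0 ltW.
  have tz : t `^ (z - 1) <= t.
    rewrite -[leRHS]powRr1 ?(ltW t0)//; apply: ler_powR => //.
    by rewrite lerBlDr.
  have et : (t / 3) ^+ 3 <= expR t.
    have -> : expR t = expR (t / 3) ^+ 3.
      by rewrite -expRM_natl; congr expR; field.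
    rewrite ler_pXn2r ?nnegrE ?expR_ge0 ?divr_ge0 ?(ltW t0)//.
    by apply: le_trans (expR_ge1Dx _); rewrite lerDr.
  rewrite expRN.
  have c0 : 0 < (t / 3) ^+ 3 by rewrite exprn_gt0// divr_gt0.
  apply: (@le_trans _ _ (t * ((t / 3) ^+ 3)^-1)).
    by apply: ler_pM; rewrite ?powR_ge0 ?invr_ge0 ?expR_ge0// lef_pV2 ?posrE ?expR_gt0.
  have -> : t * ((t / 3) ^+ 3)^-1 = 27 / t ^+ 2 by field; rewrite gt_eqF.
  rewrite ler_pdivrMr ?exprn_gt0// /oneDsqr mulrAC ler_pdivlMr ?addr_gt0 ?exprn_gt0//.
  have : 1 <= t ^+ 2 by rewrite expr_ge1// ltW.
  lra.
rewrite ge0_integralD_EFin; first last.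
- by apply: measurable_funM.
- by meas.
- by move=> t; rewrite mulr_ge0.
- by move=> t; nneg.
rewrite ge0_integralZ_EFin//.
have -> : (\int[leb]_t ((0 <= t)%R%:R * (oneDsqr t)^-1)%:E = (pi / 2)%:E)%E.
  rewrite -integral0y_oneDsqr [RHS]integral_mkcond; apply: eq_integral => t _.
  rewrite patchE mem_setE in_itv/= andbT; case: ifP => _; first by rewrite mul1r.
  by rewrite mul0r.
by rewrite -EFinM lte_add_pinfty ?ltry//; exact: integral_powR_near0.
Qed.

Lemma Cs_gt0 (s : R) : 0 < s -> s < 1 -> 0 < Cs s.
Proof.
move=> s0 s1; rewrite /Cs divr_gt0//.
- apply: mulr_gt0; first by rewrite mulr_gt0// powR_gt0.
  by apply: Gamma_gt0; lra.
- by rewrite mulr_gt0 ?sqrtr_gt0 ?pi_gt0//; apply: Gamma_gt0; lra.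
Qed.

End GammaPositivity.

(** * Cauchy subsequences and elementary inequalities *)

Lemma bounded_cauchy_subseq (R : realType) (t : nat -> R) B : (forall n, `|t n| <= B) ->
  exists phi : nat -> nat, (forall n, (phi n < phi n.+1)%N) /\
    forall e : R, 0 < e -> exists N, forall m n, (N <= m)%N -> (N <= n)%N ->
      `|t (phi m) - t (phi n)| < e.
Proof.
move=> tB; have [|f fi fc] := @bolzano_weierstrass R t.
  by exists B; split; [exact: num_real|move=> M BM x /= _; rewrite (le_trans (tB x))// ltW].
exists f; split=> [n|e e0].
  by rewrite ltnNge (fi n.+1 n : (f n.+1 <= f n)%N = (n.+1 <= n)%N) ltnn.
have [l tl] := (cvg_ex (t \o f @ \oo)).1 fc.
have e2 : 0 < e / 2 by rewrite divr_gt0.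
have /cvgrPdist_lt /(_ _ e2) [N _ HN] := tl.
exists N => m n Nm Nn; have := HN _ Nm; have := HN _ Nn; rewrite /= !ltr_norml.
by move=> /andP[h1 h2] /andP[h3 h4]; apply/andP; split; lra.
Qed.

Section Inequalities.
Variable R : realFieldType.
Implicit Types p q r c k x y : R.

Lemma quad_le_double p q r c : 0 <= q + 2 * (- c) * r + (- c) ^+ 2 * p ->
  q + 2 * c * r + c ^+ 2 * p <= 2 * c ^+ 2 * p + 2 * q.
Proof. by rewrite sqrrN; lra. Qed.

Lemma le_of_sqr_le x k : x ^+ 2 <= k -> x <= k + 1.
Proof. by have := sqr_ge0 (x - 2^-1); rewrite sqrrB; lra. Qed.

(** Young's inequality: the product of the two terms on the right is [c e w p^2 / 4], and the
    weights are chosen so that only the share [(8 k)^-1] of [w] is spent. *)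
Lemma cross_term_le k (c e p x y w : R) : 0 < k -> 0 <= c -> 0 <= e -> 0 <= w ->
  x ^+ 2 <= c * e * w -> y ^+ 2 = p ^+ 2 ->
  - (y * x) <= (8 * k)^-1 * w + 2 * k * c * e * p ^+ 2.
Proof.
move=> k0 c0 e0 w0 xw yp.
have H : (2 * - (y * x)) ^+ 2 <= 4 * (p ^+ 2 * (c * e * w)).
  rewrite [leLHS](_ : _ = 4 * (y ^+ 2 * x ^+ 2)); last by ring.
  by rewrite yp; apply: ler_wpM2l => //; apply: ler_wpM2l => //; exact: sqr_ge0.
set A := (8 * k)^-1 * w; set D := 2 * k * c * e * p ^+ 2.
have A0 : 0 <= A by rewrite mulr_ge0// invr_ge0 mulr_ge0// ltW.
have D0 : 0 <= D by apply: mulr_ge0; [rewrite !mulr_ge0// ltW|exact: sqr_ge0].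
have AD : 4 * (p ^+ 2 * (c * e * w)) = 16 * (A * D) by rewrite /A /D; field; rewrite gt_eqF.
rewrite AD in H; have [yx|yx] := ltP (- (y * x)) 0; first by rewrite (le_trans (ltW yx))// addr_ge0.
rewrite -(@ler_pXn2r _ 2)// ?nnegrE ?addr_ge0//.
have := sqr_ge0 (A - D); rewrite sqrrB sqrrD.
move: H; rewrite exprMn; move: ((- (y * x)) ^+ 2) (A ^+ 2) (D ^+ 2) (A * D) => q1 q2 q3 q4; lra.
Qed.

(** The hypothesis on [z] supplies [w / k]; the cross terms spend [w / (4 k)] together and
    [v / (4 k)] spends [w / (2 k)], so what has to be subtracted is a multiple of [p2]. *)
Lemma combine_coercive k (c e p2 w v n t1 t2 t3 z : R) : 0 < k -> 0 <= e -> 0 <= c ->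
  0 <= p2 -> 0 <= w ->
  - t1 <= (8 * k)^-1 * w + 2 * k * c * e * p2 -> - t2 <= (8 * k)^-1 * w + 2 * k * c * e * p2 ->
  - (n * p2) <= t3 -> w <= k * z -> v <= 2 * p2 * e + 2 * w ->
  (4 * k)^-1 * v - (n + 4 * k * c * e + k^-1 * e + 1) * p2 <= t3 + t1 + t2 + z.
Proof.
move=> k0 e0 c0 p20 w0; rewrite !invfM; have i0 : 0 <= k^-1 by rewrite invr_ge0 ltW.
move=> h1 h2 h3 wz vw; have H4 : k^-1 * w <= z by rewrite ler_pdivrMl.
have H5 : k^-1 * v <= k^-1 * (2 * p2 * e + 2 * w) by exact: ler_wpM2l.
have H6 : 0 <= k^-1 * w by rewrite mulr_ge0.
have H7 : 0 <= k^-1 * (p2 * e) by rewrite !mulr_ge0.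
by move: (k^-1) h1 h2 H4 H5 H6 H7 => i; lra.
Qed.

End Inequalities.

(** * The operators T and K, and weak T-coercivity *)

Section Coercivity.
Variable R : realType.
Variables (s b s1 s2 : R) (psi : R -> R).
Hypotheses (s12 : 2^-1 < s) (s_lt1 : s < 1) (b0 : 0 < b) (b1 : b < 1).
Hypotheses (s1_gt0 : 0 < s1) (s2_lt0 : s2 < 0).
Hypotheses (Hpsi : Hts s psi) (psib : psi b = 1).

Local Lemma s0 : 0 < s. Proof. by rewrite (lt_trans _ s12)// invr_gt0. Qed.
Local Notation a := (tform R s b s1 s2).
Local Notation S := (sform R s b s1 s2).
Local Notation E := (energy R s).
Local Notation c2 := (Cs s / 2).

Local Lemma c2_gt0 : 0 < c2. Proof. by rewrite divr_gt0//; apply: Cs_gt0; [exact: s0|exact: s_lt1]. Qed.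

Local Lemma linS u v w c : Hts s u -> Hts s v -> Hts s w ->
  S (fun x => c * u x + v x) w = c * S u w + S v w.
Proof.
move=> Hu Hv Hw.
by apply: (bform_linear R s _ _ (measurable_rhoD R b s1 s2)
  (rhoD_norm_le R b s1 s2 s1_gt0 s2_lt0)); exact: Hts_finite_energy.
Qed.

Local Lemma lina u v w c : Hts s u -> Hts s v -> Hts s w ->
  a (fun x => c * u x + v x) w = c * a u w + a v w.
Proof.
move=> Hu Hv Hw.
by apply: (bform_linear R s _ _ (measurable_rhoB R b s1 s2)
  (rhoB_norm_le R b s1 s2 s1_gt0 s2_lt0)); exact: Hts_finite_energy.
Qed.

Local Lemma aC u v : a u v = a v u. Proof. exact: bformC. Qed.
Local Lemma SC u v : S u v = S v u. Proof. exact: bformC. Qed.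

Local Lemma linar u v w c : Hts s u -> Hts s v -> Hts s w ->
  a w (fun x => c * u x + v x) = c * a w u + a w v.
Proof. by move=> Hu Hv Hw; rewrite aC lina// (aC u) (aC v). Qed.

Local Lemma linSr u v w c : Hts s u -> Hts s v -> Hts s w ->
  S w (fun x => c * u x + v x) = c * S w u + S w v.
Proof. by move=> Hu Hv Hw; rewrite SC linS// (SC u) (SC v). Qed.

Local Lemma S_ge0 u : 0 <= S u u.
Proof. by apply: bform_ge0 => z; apply: addr_ge0; [exact: rho1_ge0|exact: rho2_ge0]. Qed.

Local Lemma S_eq0 u : Hts s u -> S u u = 0 -> u = (fun=> 0).
Proof.
move=> Hu S0; apply: (energy_eq0 R s s12) => //; apply/eqP; rewrite eq_le energy_ge0 andbT.
by have := sform_coercive R s b s1 s2 s12 b0 b1 s1_gt0 s2_lt0 u Hu; rewrite S0 mulr0.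
Qed.

Local Lemma E_linear u v c : Hts s u -> Hts s v ->
  E (fun x => c * u x + v x) <= 2 * c ^+ 2 * E u + 2 * E v.
Proof.
move=> Hu Hv; have fu := Hts_finite_energy R s _ Hu; have fv := Hts_finite_energy R s _ Hv.
have n1 (z : R * R) : `|1 : R| <= 1 by rewrite normr1.
have m1 : measurable_fun setT (fun _ : R * R => 1 : R) by exact: measurable_cst.
have L (u' v' w' : R -> R) c' := bform_linear R s (fun=> 1) 1 m1 n1 u' v' w' c'.
have Q := form_quadratic R R (finite_energy R s) (bform R s (fun=> 1))
  (fun u v c => finite_energy_linear R s u v c) (bformC R s (fun=> 1)) L.
have fl t := finite_energy_linear R s u v t fu fv.
have H := bform_ge0 R s (fun=> 1) (fun x => - c * u x + v x) (fun=> ler01).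
rewrite (Q _ _ _ fu fv) in H.
rewrite -(bform_energy R s _ (fl c)) -(bform_energy R s _ fu) -(bform_energy R s _ fv) (Q _ _ _ fu fv).
exact: quad_le_double.
Qed.

Local Lemma E_scale c v : Hts s v -> E (fun x => c * v x) = c ^+ 2 * E v.
Proof.
move=> Hv; have fv := Hts_finite_energy R s _ Hv; have [mv _] := fv.
have mcv : measurable_fun setT (fun x => c * v x) by apply: measurable_funM.
have H : (gagliardo s (fun x => (c * v x)%R) = (c ^+ 2)%:E * gagliardo s v)%E.
  rewrite (gagliardoE R s _ mcv) (gagliardoE R s _ mv) -ge0_integralZ_EFin.
  - by apply: eq_integral => z _; congr EFin; rewrite /energy_density; ring.
  - exact: sqr_ge0.
  - by move=> z; exact: energy_density_ge0.
  - exact: measurable_energy_density.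
by rewrite /energy H -(energyK R s v fv) -EFinM.
Qed.

Local Lemma Hnorm2E w : Hnorm2 s w = c2 * E w. Proof. by []. Qed.

(* Keeps unification from unfolding the integrals. *)
#[local] Opaque energy tform sform Cs supC gconst.

Let v0 (v : R -> R) : R -> R := fun x => - v b * psi x + v x.

Local Lemma v0_Hts v : Hts s v -> Hts s (v0 v). Proof. by move=> Hv; exact: Hts_linear. Qed.

Local Lemma v0b v : v0 v b = 0. Proof. by rewrite /v0 psib mulr1 addNr. Qed.

Local Lemma E_v0 : exists2 M, 0 <= M & forall v, Hts s v -> E (v0 v) <= M * E v.
Proof.
exists (2 * (supC R s * E psi) + 2).
  apply: addr_ge0; [apply: mulr_ge0; [|apply: mulr_ge0]|]; rewrite ?ler0n//; [exact: supC_ge0|exact: energy_ge0].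
move=> v Hv; apply: (le_trans (E_linear _ _ _ Hpsi Hv)); rewrite sqrrN.
have := sup_le_energy R s s12 v b Hv => H.
rewrite [leRHS]mulrDl; apply: lerD; last exact: lexx.
rewrite [leLHS](_ : _ = 2 * (v b ^+ 2 * E psi)); last by rewrite mulrA.
rewrite [leRHS](_ : _ = 2 * ((supC R s * E v) * E psi)); last by ring.
by apply: ler_wpM2l; [exact: ler0n|apply: ler_wpM2r; [exact: energy_ge0|exact: H]].
Qed.

Local Lemma flipv0_Hts v : Hts s v -> Hts s (flip R b (v0 v)).
Proof. by move=> Hv; have [] := flip_Hts R s b s12 _ (v0_Hts v Hv) (v0b v). Qed.

Local Lemma E_flipv0 : exists2 M, 0 <= M & forall v, Hts s v -> E (flip R b (v0 v)) <= M * E v.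
Proof.
have [M M0 HM] := E_v0; exists (2 * gconst R s * M).
  by rewrite mulr_ge0// mulr_ge0// gconst_ge0.
move=> v Hv; have [_ H] := flip_Hts R s b s12 _ (v0_Hts v Hv) (v0b v).
apply: (le_trans H); rewrite [leRHS](_ : _ = 2 * gconst R s * (M * E v)); last by ring.
by apply: ler_wpM2l; [apply: mulr_ge0; [exact: ler0n|exact: gconst_ge0]|exact: HM].
Qed.

Variable eps : R.
Hypothesis eps2 : eps ^+ 2 = 1.

Definition flip_map (v : R -> R) : R -> R := fun x => (eps * v b) * psi x + flip R b (v0 v) x.

Let T := flip_map.

Local Lemma T_Hts v : Hts s v -> Hts s (T v).
Proof. by move=> Hv; exact: (Hts_linear R s _ _ _ Hpsi (flipv0_Hts v Hv)). Qed.

Local Lemma flipb w : flip R b w b = w b. Proof. by rewrite /flip ltxx. Qed.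

(** [T] multiplies the value at [b] by [eps] and flips the part vanishing at [b]; both operations
    are their own inverses, since [eps^2 = 1]. *)
Local Lemma TK v : T (T v) = v.
Proof.
apply/funext => x; have Tb : T v b = eps * v b by rewrite /T /flip_map flipb v0b psib mulr1 addr0.
have -> : T (T v) x = (eps * T v b) * psi x + flip R b (v0 (T v)) x by [].
have -> : flip R b (v0 (T v)) x = v0 v x.
  have e : v0 (T v) x = flip R b (v0 v) x by rewrite {1}/v0 Tb /T /flip_map; ring.
  by rewrite /flip; case: ifP => bx; rewrite e /flip bx ?opprK.
by rewrite Tb mulrA -expr2 eps2 mul1r /v0; ring.
Qed.

Local Lemma T_linear u v c : T (fun x => c * u x + v x) = (fun x => c * T u x + T v x).
Proof. by apply/funext => x; rewrite /T /flip_map /flip /v0; case: ifP => _; ring. Qed.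

Local Lemma E_pointval v : Hts s v -> v b ^+ 2 <= supC R s * E v.
Proof. by move=> Hv; exact: sup_le_energy. Qed.

Lemma flip_map_bounded : bounded_linear_op s T.
Proof.
split; first exact: T_Hts.
split; first by move=> u v c _ _; exact: T_linear.
have [M M0 HM] := E_flipv0.
exists (2 * (supC R s * E psi) + 2 * M) => v Hv.
rewrite !Hnorm2E mulrCA; apply: (ler_wpM2l (ltW c2_gt0)).
have H1 := E_linear _ _ (eps * v b) Hpsi (flipv0_Hts v Hv); rewrite exprMn eps2 mul1r in H1.
apply: (le_trans H1); rewrite [leRHS]mulrDl; apply: lerD.
  rewrite [leLHS](_ : _ = 2 * (v b ^+ 2 * E psi)); last by rewrite mulrA.
  rewrite [leRHS](_ : _ = 2 * ((supC R s * E v) * E psi)); last by ring.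
  apply: ler_wpM2l; first exact: ler0n.
  by apply: ler_wpM2r; [exact: energy_ge0|exact: E_pointval].
rewrite [leRHS](_ : _ = 2 * (M * E v)); last by ring.
by apply: ler_wpM2l; [exact: ler0n|exact: HM].
Qed.

Lemma flip_map_bijective : Hbijective s T.
Proof.
move=> w Hw; exists (T w); split; first exact: T_Hts.
by split; [exact: TK|move=> v' _ <-; rewrite TK].
Qed.

Local Lemma a_flip u w : Hts s w -> a u (flip R b w) = S u w.
Proof. by move=> Hw; exact: tform_flip Hw. Qed.

Local Lemma a_bounded u v : Hts s u -> Hts s v ->
  a u v ^+ 2 <= 4 * sigma_bound R s1 s2 ^+ 2 * E u * E v.
Proof. by move=> Hu Hv; exact: tform_bounded. Qed.

Local Lemma vE v : v = (fun x => v b * psi x + v0 v x).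
Proof. by apply/funext => x; rewrite /v0; ring. Qed.

Local Notation Cbound := (4 * sigma_bound R s1 s2 ^+ 2).
Local Lemma Cbound0 : 0 <= Cbound. Proof. by apply: mulr_ge0 => //; exact: sqr_ge0. Qed.

Definition pointval_map (v : R -> R) : R -> R := fun x => v b * psi x.

Local Lemma zero_Hts : Hts s (fun=> 0).
Proof.
have := Hts_linear R s psi psi (-1) Hpsi Hpsi.
by rewrite (_ : (fun x => _) = (fun=> 0))//; apply/funext => x; ring.
Qed.

Local Lemma scale_Hts c v : Hts s v -> Hts s (fun x => c * v x).
Proof.
move=> Hv; have := Hts_linear R s v _ c Hv zero_Hts.
by rewrite (_ : (fun x => _) = (fun x => c * v x))//; apply/funext => x; rewrite addr0.
Qed.

(** Rank one: a bounded sequence has bounded values at [b], and Bolzano-Weierstrass applies to these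
    numbers. *)
Lemma pointval_map_compact : compact_op s pointval_map.
Proof.
split; [split; [|split]|].
- by move=> v Hv; exact: scale_Hts.
- by move=> u v c Hu Hv; apply/funext => x; rewrite /pointval_map; ring.
- exists (supC R s * E psi) => v Hv; rewrite !Hnorm2E.
  rewrite (E_scale _ _ Hpsi) [leRHS]mulrCA; apply: (ler_wpM2l (ltW c2_gt0)).
  rewrite [leRHS](_ : _ = (supC R s * E v) * E psi); last by rewrite mulrAC.
  by apply: ler_wpM2r; [exact: energy_ge0|exact: E_pointval].
move=> vn M Hv vM; pose t n := vn n b.
have tb n : `|t n| <= supC R s * (M / c2) + 1.
  have : t n ^+ 2 <= supC R s * (M / c2).
    apply: (le_trans (E_pointval _ (Hv n))); apply: ler_wpM2l; first exact: supC_ge0.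
    by rewrite (ler_pdivlMr _ _ c2_gt0) mulrC -Hnorm2E; exact: vM.
  by rewrite -real_normK ?num_real//; exact: le_of_sqr_le.
have [phi [phi_mono phi_cvg]] := bounded_cauchy_subseq R t _ tb.
exists phi; split => // e e0.
have k0 : 0 < c2 * E psi + 1 by rewrite ltr_wpDl//; apply: mulr_ge0; [exact: ltW c2_gt0|exact: energy_ge0].
(* A tolerance of at most 1 allows [d^2] to be replaced by [d]. *)
have d0 : 0 < Num.min 1 (e / (c2 * E psi + 1)) by rewrite lt_min ltr01 divr_gt0.
have [N HN] := phi_cvg _ d0; exists N => m n Nm Nn.
rewrite (_ : (fun x => _) = (fun x => (t (phi m) - t (phi n)) * psi x)); last first.
  by apply/funext => x; rewrite /pointval_map /t; ring.
rewrite Hnorm2E (E_scale _ _ Hpsi).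
have := HN m n Nm Nn; rewrite lt_min => /andP[h1 h2].
rewrite -real_normK ?num_real//; set d := `|_| in h1 h2 *.
apply: (@le_lt_trans _ _ (d * (c2 * E psi + 1))).
  rewrite [leLHS](_ : _ = d ^+ 2 * (c2 * E psi)); last by ring.
  have cE : 0 <= c2 * E psi by apply: mulr_ge0; [exact: ltW c2_gt0|exact: energy_ge0].
  apply: ler_pM; [exact: sqr_ge0|exact: cE| |by rewrite lerDl].
  by rewrite expr2; apply: ler_piMl; [exact: normr_ge0|exact: ltW].
by rewrite -ltr_pdivlMr.
Qed.

(* With [v = v0 + v(b) psi] the form at (v, T v) is the coercive form S(v0, v0) up to
   terms controlled by [v(b)], absorbed by Young's inequality. *)
Lemma weak_T_coercive : exists alpha beta : R, 0 < alpha /\ 0 < beta /\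
  forall v, Hts s v -> c2 * `|a v (T v)| >=
    alpha * Hnorm2 s v - beta * Hnorm2 s (pointval_map v).
Proof.
pose k := coerc R s s1 s2 + 1.
have k0 : 0 < k by rewrite ltr_wpDl// coerc_ge0.
have psiE : 0 < E psi.
  rewrite lt_neqAle energy_ge0 andbT eq_sym; apply/eqP => E0.
  have := energy_eq0 R s s12 psi Hpsi E0 => p0.
  by move: psib; rewrite p0 => /eqP; rewrite eq_sym oner_eq0.
pose B := `|a psi psi| + 4 * k * Cbound * E psi + k^-1 * E psi + 1.
have C0 := Cbound0.
have B0 : 0 < B.
  rewrite ltr_wpDl// !addr_ge0//; last by rewrite mulr_ge0 ?energy_ge0// invr_ge0 ltW.
  by rewrite mulr_ge0 ?energy_ge0// mulr_ge0// mulr_ge0// ltW.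
(* The norm of [pointval_map v] contains [v(b)^2 E psi], so the division leaves [B v(b)^2]. *)
exists ((4 * k)^-1), (B / E psi); split; first by rewrite invr_gt0 mulr_gt0.
split; first by rewrite divr_gt0.
move=> v Hv; rewrite !Hnorm2E (E_scale _ _ Hpsi).
rewrite [leLHS](_ : _ = c2 * ((4 * k)^-1 * E v - B * v b ^+ 2)); last by field; rewrite !gt_eqF.
apply: (ler_wpM2l (ltW c2_gt0)).
have Hw := v0_Hts v Hv; have Hf := flipv0_Hts v Hv.
set w := v0 v in Hw Hf *; set p := v b.
have Ev : E v <= 2 * p ^+ 2 * E psi + 2 * E w.
  by rewrite {1}(vE v); exact: E_linear.
have Sw : E w <= k * S w w.
  have := sform_coercive R s b s1 s2 s12 b0 b1 s1_gt0 s2_lt0 w Hw => H.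
  by apply: (le_trans H); apply: ler_wpM2r; [exact: S_ge0|rewrite /k lerDl ler01].
(* The term [S w w = a w (flip w)] is the coercive one; the other three contain [p = v b]. *)
have expand : a v (T v) = eps * p ^+ 2 * a psi psi + p * a psi (flip R b w) +
    (eps * p) * a psi w + S w w.
  have -> : a v (T v) = a (fun x => p * psi x + w x) (fun x => (eps * p) * psi x + flip R b w x).
    have vw : v = (fun x => p * psi x + w x) by exact: vE.
    by rewrite {1}vw.
  have HT : Hts s (fun x => (eps * p) * psi x + flip R b w x) by exact: Hts_linear.
  rewrite (lina _ _ _ _ Hpsi Hw HT) (linar _ _ _ _ Hpsi Hf Hpsi) (linar _ _ _ _ Hpsi Hf Hw).
  rewrite (a_flip w w Hw) (aC w psi); ring.
have c2' := a_bounded _ _ Hpsi Hw.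
have a1 : a psi (flip R b w) = S psi w by exact: a_flip.
rewrite expand a1.
have SCS : S psi w ^+ 2 <= Cbound * E psi * E w.
  have H := @form_cauchy_schwarz R R (Hts s) S (fun u v c => Hts_linear R s u v c) SC
    (fun u v w c => linS u v w c) (fun u _ => S_ge0 u) psi w Hpsi Hw.
  apply: (le_trans H).
  have up u : Hts s u -> S u u <= sigma_bound R s1 s2 * E u.
    by move=> Hu; apply: sform_le_energy => //; exact: Hts_finite_energy.
  apply: (@le_trans _ _ ((sigma_bound R s1 s2 * E psi) * (sigma_bound R s1 s2 * E w))).
    by apply: ler_pM; [exact: S_ge0|exact: S_ge0|exact: up|exact: up].
  rewrite [leLHS](_ : _ = sigma_bound R s1 s2 ^+ 2 * (E psi * E w)); last by ring.
  rewrite [leRHS](_ : _ = 4 * (sigma_bound R s1 s2 ^+ 2 * (E psi * E w))); last by ring.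
  rewrite ler_peMl ?ler1n//; apply: mulr_ge0; first exact: sqr_ge0.
  by apply: mulr_ge0; exact: energy_ge0.
have EW0 : 0 <= E w by exact: energy_ge0.
have F1 := cross_term_le R k _ _ p _ p _ k0 Cbound0 (ltW psiE) EW0 SCS erefl.
have ep : (eps * p) ^+ 2 = p ^+ 2 by rewrite exprMn eps2 mul1r.
have F2 := cross_term_le R k _ _ p _ (eps * p) _ k0 Cbound0 (ltW psiE) EW0 c2' ep.
apply: le_trans (ler_norm _).
have F3 : - (`|a psi psi| * p ^+ 2) <= eps * p ^+ 2 * a psi psi.
  have ne : `|eps| = 1 by move/eqP: eps2; rewrite sqrf_eq1 => /orP[]/eqP->; rewrite ?normrN normr1.
  have -> : `|a psi psi| * p ^+ 2 = `|eps * p ^+ 2 * a psi psi|.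
    by rewrite -mulrA normrM ne mul1r normrM (ger0_norm (sqr_ge0 p)) mulrC.
  by rewrite lerNl -normrN ler_norm.
exact: (combine_coercive R k Cbound (E psi) (p ^+ 2) (E w) _ _ _ _ _ _ k0 (ltW psiE) Cbound0 (sqr_ge0 p) EW0 F1 F2 F3 Sw Ev).
Qed.

(** * Solvability by Riesz' theorem and the Fredholm property *)

Local Lemma S_complete (u_ : nat -> R -> R) : (forall n, Hts s (u_ n)) ->
  (forall e, 0 < e -> exists N, forall m n, (N <= m)%N -> (N <= n)%N ->
     S (fun x => -1 * u_ n x + u_ m x) (fun x => -1 * u_ n x + u_ m x) <= e) ->
  exists2 u, Hts s u & forall e, 0 < e -> exists N, forall n, (N <= n)%N ->
     S (fun x => -1 * u_ n x + u x) (fun x => -1 * u_ n x + u x) <= e.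
Proof.
move=> Hu Su.
have C0 : 0 <= coerc R s s1 s2 by exact: coerc_ge0.
have B0 : 0 <= sigma_bound R s1 s2 by exact: sigma_bound_ge0.
have scale (C e : R) : 0 <= C -> 0 < e -> 0 < e / (C + 1) /\ forall x, x <= e / (C + 1) -> C * x <= e.
  move=> CC e0; have C1 : 0 < C + 1 by rewrite ltr_wpDl.
  split=> [|x xe]; first by rewrite divr_gt0.
  apply: (le_trans (ler_wpM2l CC xe)).
  by rewrite mulrA ler_pdivrMr// [leRHS]mulrC ler_wpM2r ?(ltW e0)// lerDl ler01.
have [|u Hu' uE] := energy_complete R s s12 u_ Hu.
  move=> e e0; have [e1 H] := scale _ _ C0 e0; have [N HN] := Su _ e1.
  exists N => m n Nm Nn; have Hd := Hts_linear R s _ _ (-1) (Hu n) (Hu m).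
  apply: (le_trans (sform_coercive R s b s1 s2 s12 b0 b1 s1_gt0 s2_lt0 _ Hd)).
  by apply: H; exact: HN.
exists u => // e e0; have [e1 H] := scale _ _ B0 e0; have [N HN] := uE _ e1.
exists N => n Nn; have Hd := Hts_linear R s _ _ (-1) (Hu n) Hu'.
have H2 : S (fun x => -1 * u_ n x + u x) (fun x => -1 * u_ n x + u x) <=
    sigma_bound R s1 s2 * E (fun x => -1 * u_ n x + u x).
  by apply: sform_le_energy => //; exact: Hts_finite_energy.
by apply: (le_trans H2); apply: H; exact: HN.
Qed.

Local Lemma riesz_sform f : Hdual s f ->
  exists2 h, Hts s h & forall v, Hts s v -> S h v = f v.
Proof.
move=> [flin [M fM]].
apply: (riesz R R (Hts s) S (fun u v c => Hts_linear R s u v c) SC (fun u v w c => linS u v w c)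
  (fun u _ => S_ge0 u) S_complete f (`|M| * c2 * coerc R s s1 s2) psi Hpsi).
  by move=> u v c Hu Hv; exact: flin.
move=> v Hv; have := fM v Hv; rewrite real_normK ?num_real// Hnorm2E => H.
apply: (le_trans H); apply: (@le_trans _ _ (`|M| * (c2 * E v))).
  apply: ler_wpM2r; last exact: ler_norm.
  by apply: mulr_ge0; [exact: ltW c2_gt0|exact: energy_ge0].
rewrite [leRHS](_ : _ = `|M| * (c2 * (coerc R s s1 s2 * S v v))); last by ring.
apply: ler_wpM2l; first exact: normr_ge0.
by apply: ler_wpM2l; [exact: ltW c2_gt0|exact: sform_coercive].
Qed.

Local Lemma pointval_Hdual : Hdual s (fun v => v b).
Proof.
split; first by [].
exists (supC R s / c2) => v Hv; rewrite real_normK ?num_real// Hnorm2E.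
have c20 : c2 != 0 by rewrite gt_eqF ?c2_gt0.
by rewrite mulrA (divfK c20); exact: E_pointval.
Qed.

Local Lemma flipK w x : flip R b (flip R b w) x = w x.
Proof. by rewrite /flip; case: (b < x); rewrite ?opprK. Qed.

Local Lemma v0_id w : w b = 0 -> v0 w = w.
Proof. by move=> wb; apply/funext => x; rewrite /v0 wb oppr0 mul0r add0r. Qed.

(** [flip] is an involution, so [a u (v0 v) = a u (flip (flip (v0 v)))]: off the direction [psi] the
    indefinite form is the coercive one. *)
Local Lemma a_v0 u v : Hts s u -> Hts s v ->
  a u v = v b * a u psi + S u (flip R b (v0 v)).
Proof.
move=> Hu Hv; rewrite {1}(vE v) (linar _ _ _ _ Hpsi (v0_Hts v Hv) Hu); congr (_ + _).
by rewrite -(a_flip _ _ (flipv0_Hts v Hv)); congr (a _ _); apply/funext => x; rewrite flipK.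
Qed.

(** [g] represents [c2^-1 f (flip (v0 v))] with respect to [S]. Against a test function vanishing at
    [b] the two flips cancel and [g] solves the equation exactly, so the defect sees only [v b]. *)
Local Lemma solve_modulo_psi f : Hdual s f -> exists2 g, Hts s g &
  forall v, Hts s v -> c2 * a g v = f v + v b * (c2 * a g psi - f psi).
Proof.
move=> Hf; have [flin [M fM]] := Hf; have c20 : c2 != 0 by rewrite gt_eqF ?c2_gt0.
have [g Hg gF] : exists2 g, Hts s g & forall v, Hts s v -> S g v = c2^-1 * f (flip R b (v0 v)).
  apply: riesz_sform; split.
    move=> u v c Hu Hv.
    have -> : flip R b (v0 (fun x => c * u x + v x)) =
        (fun x => c * flip R b (v0 u) x + flip R b (v0 v) x).
      by apply/funext => x; rewrite /flip /v0; case: ifP => _; ring.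
    by rewrite (flin _ _ _ (flipv0_Hts u Hu) (flipv0_Hts v Hv)); ring.
  have [K K0 HK] := E_flipv0; exists (c2^-1 ^+ 2 * (`|M| * K)) => v Hv.
  have := fM _ (flipv0_Hts v Hv); rewrite Hnorm2E => H.
  rewrite normrM exprMn (real_normK (num_real c2^-1)) Hnorm2E.
  rewrite [leRHS](_ : _ = c2^-1 ^+ 2 * (`|M| * (c2 * (K * E v)))); last by ring.
  apply: ler_wpM2l; first exact: sqr_ge0.
  apply: (le_trans H); apply: (@le_trans _ _ (`|M| * (c2 * E (flip R b (v0 v))))).
    apply: ler_wpM2r; last exact: ler_norm.
    by apply: mulr_ge0; [exact: ltW c2_gt0|exact: energy_ge0].
  apply: ler_wpM2l; first exact: normr_ge0.
  by apply: ler_wpM2l; [exact: ltW c2_gt0|exact: HK].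
exists g => // v Hv; rewrite (a_v0 _ _ Hg Hv) (gF _ (flipv0_Hts v Hv)).
have fb : flip R b (v0 v) b = 0 by rewrite flipb v0b.
rewrite (v0_id _ fb) (_ : flip R b (flip R b (v0 v)) = v0 v); last by apply/funext => x; rewrite flipK.
have -> : f (v0 v) = - v b * f psi + f v by rewrite -flin.
rewrite mulrDr (mulVKf c20); ring.
Qed.

Local Lemma aformE0 u v : Hts s u -> Hts s v -> aform s b s1 s2 0 u v = c2 * a u v.
Proof. by move=> Hu Hv; exact: aformE. Qed.

Lemma aform_Hdual u : Hts s u -> Hdual s (aform s b s1 s2 0 u).
Proof.
move=> Hu; split.
  move=> v w c Hv Hw; have Hl := Hts_linear R s _ _ c Hv Hw.
  by rewrite !aformE0// (linar _ _ _ _ Hv Hw Hu); ring.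
exists (c2 * Cbound * E u) => v Hv; rewrite (aformE0 _ _ Hu Hv) Hnorm2E normrM exprMn.
rewrite !real_normK ?num_real// [leRHS](_ : _ = c2 ^+ 2 * (Cbound * E u * E v)); last by ring.
by apply: ler_wpM2l; [exact: sqr_ge0|exact: a_bounded].
Qed.

(* With [S h w = w(b)], the kernel of the form is contained in the line of [h], and [h]
   annihilates all test functions as soon as it annihilates [psi]; the solution built from
   Riesz' theorem fails by a multiple of the evaluation at [b] only. *)
Lemma aform_fredholm : fredholm_index0 s (aform s b s1 s2 0).
Proof.
have [h Hh hS] := riesz_sform _ pointval_Hdual.
have c20 : c2 != 0 by rewrite gt_eqF ?c2_gt0.
have hpsi : S h psi = 1 by rewrite hS.
(* [h b = S h h], and [S h psi = 1] excludes [h = 0]. *)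
have hb : h b != 0.
  apply/eqP => hb0; have h0 : h = (fun=> 0) by apply: (S_eq0 _ Hh); rewrite hS.
  have := linSr psi psi psi (-1) Hpsi Hpsi Hpsi.
  rewrite (_ : (fun x => -1 * psi x + psi x) = h); last by rewrite h0; apply/funext => x; ring.
  by rewrite SC hpsi mulN1r addNr => /eqP; rewrite oner_eq0.
have ah v : Hts s v -> a h v = v b * a h psi.
  move=> Hv; rewrite (a_v0 _ _ Hh Hv) (hS _ (flipv0_Hts v Hv)) flipb v0b addr0//.
(* [S u] kills the functions vanishing at [b], so it is [S u psi] times the evaluation at [b], and
   [u - (S u psi) h] is [S]-orthogonal to everything. Testing only with flips of such functions lets
   the claim serve for the cokernel too. *)
have ker u : Hts s u -> (forall w, Hts s w -> w b = 0 -> a u (flip R b w) = 0) ->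
    u = (fun x => S u psi * h x).
  move=> Hu H; set t := S u psi.
  have Hd := Hts_linear R s _ _ (- t) Hh Hu.
  have Sd w : Hts s w -> S (fun x => - t * h x + u x) w = 0.
    move=> Hw; rewrite (linS _ _ _ _ Hh Hu Hw) (hS _ Hw).
    rewrite {2}(vE w) (linSr _ _ _ _ Hpsi (v0_Hts w Hw) Hu) -/t.
    rewrite -(a_flip u _ (v0_Hts w Hw)) (H _ (v0_Hts w Hw) (v0b w)); ring.
  have d0 := S_eq0 _ Hd (Sd _ Hd); apply/funext => x.
  by have := congr1 (fun F => F x) d0; rewrite /= => /eqP; rewrite mulNr addrC subr_eq0 => /eqP.
have kerA u : Hts s u -> (forall v, Hts s v -> aform s b s1 s2 0 u v = 0) ->
    u = (fun x => S u psi * h x).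
  move=> Hu H; apply: ker => // w Hw wb.
  have [Hf _] := flip_Hts R s b s12 w Hw wb.
  by apply/eqP; have /eqP := H _ Hf; rewrite (aformE0 _ _ Hu Hf) mulf_eq0 (negbTE c20).
have ascale t : a (fun x => t * h x) psi = t * a h psi.
  have := linar h (fun=> 0) psi t Hh zero_Hts Hpsi.
  rewrite (_ : (fun x => t * h x + 0) = (fun x => t * h x)); last by apply/funext => x; rewrite addr0.
  have -> : a psi (fun=> 0) = 0.
    have := linar psi psi psi (-1) Hpsi Hpsi Hpsi.
    rewrite (_ : (fun x => _) = (fun=> 0)); last by apply/funext => x; ring.
    by rewrite mulN1r addNr.
  by rewrite addr0 aC (aC psi h).
have [hp|hp] := eqVneq (a h psi) 0; last first.
  (* When [a h psi] is nonzero, a multiple of [h] cancels the defect of the solution; families over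
     ['I_0] are empty. *)
  exists 0%N; split.
    exists (fun _ => h); split; first by case.
    split; first by move=> c _ [].
    move=> u Hu H; exists (fun=> 0); have uE := kerA u Hu H.
    have S0 : S u psi = 0.
      apply/eqP; have /eqP := H _ Hpsi; rewrite (aformE0 _ _ Hu Hpsi) {1}uE ascale.
      by rewrite mulf_eq0 (negbTE c20) /= mulf_eq0 (negbTE hp) orbF.
    by rewrite uE S0; apply/funext => x; rewrite big_ord0 mul0r.
  exists (fun _ _ => 0); split; first by case.
  split; last by move=> u c _ _ [].
  move=> f Hf; have [g Hg gE] := solve_modulo_psi f Hf.
  pose t := (f psi - c2 * a g psi) / (c2 * a h psi).
  have Hu := Hts_linear R s _ _ t Hh Hg.
  exists (fun x => t * h x + g x), (fun=> 0); split => // v Hv.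
  rewrite big_ord0 addr0 (aformE0 _ _ Hu Hv) (lina _ _ _ _ Hh Hg Hv) (ah _ Hv) mulrDr (gE _ Hv).
  have tE : t * (c2 * a h psi) = f psi - c2 * a g psi by rewrite /t divfK// mulf_neq0.
  rewrite [X in _ = X + _](_ : _ = v b * (t * (c2 * a h psi))); last by ring.
  by rewrite tE; ring.
(* When [a h psi = 0], the kernel is the line of [h], and the evaluation at [b] spans a complement
   of the range. *)
exists 1%N; split.
  exists (fun _ => h); split.
    by move=> _; split => // v Hv; rewrite (aformE0 _ _ Hh Hv) (ah _ Hv) hp !mulr0.
  split.
    move=> c H i; have := congr1 (fun F => F b) H; rewrite /= big_ord1 => /eqP.
    by rewrite mulf_eq0 (negbTE hb) orbF (ord1 i) => /eqP.
  move=> u Hu H; exists (fun=> S u psi); rewrite {1}(kerA u Hu H).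
  by apply/funext => x; rewrite big_ord1.
exists (fun _ v => v b); split; first by move=> _; exact: pointval_Hdual.
split.
  move=> f Hf; have [g Hg gE] := solve_modulo_psi f Hf.
  exists g, (fun=> - (c2 * a g psi - f psi)); split => // v Hv.
  by rewrite big_ord1 (aformE0 _ _ Hg Hv) (gE _ Hv); ring.
move=> u c Hu H i; rewrite (ord1 i).
have uE : u = (fun x => S u psi * h x).
  apply: ker => // w Hw wb; have [Hf _] := flip_Hts R s b s12 w Hw wb.
  have /eqP := H _ Hf; rewrite big_ord1 flipb wb mulr0 addr0 (aformE0 _ _ Hu Hf).
  by rewrite mulf_eq0 (negbTE c20) => /eqP.
have := H _ Hpsi; rewrite big_ord1 psib mulr1 (aformE0 _ _ Hu Hpsi) {1}uE ascale hp.
by rewrite !mulr0 add0r.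
Qed.

End Coercivity.
Theorem theorem2p5 (R : realType) (s b s1 s2 s3 : R) (psi : R -> R) :
  2^-1 < s -> s < 1 -> 0 < b -> b < 1 ->
  0 < s1 -> s2 < 0 -> s3 = 0 ->
  Hts s psi -> psi b = 1 ->
  0 < Phi s (I1 b) psi -> 0 < Phi s (I2 b) psi ->
  `|s2| / s1 != Phi s (I1 b) psi / Phi s (I2 b) psi ->
  [/\ bounded_linear_op s (Tmap s b s1 s2 psi),
      Hbijective s (Tmap s b s1 s2 psi),
      (exists K, compact_op s K /\
        exists alpha beta : R, 0 < alpha /\ 0 < beta /\
          forall v, Hts s v ->
            `|aform s b s1 s2 s3 v (Tmap s b s1 s2 psi v)|
              >= alpha * Hnorm2 s v - beta * Hnorm2 s (K v)),
      (forall u, Hts s u -> Hdual s (aform s b s1 s2 s3 u)) &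
      fredholm_index0 s (aform s b s1 s2 s3)].
Proof.
move=> s12 s_lt1 b0 b1 s1_gt0 s2_lt0 -> Hpsi psib P1_gt0 P2_gt0 ratio.
set eps := epsT s b s1 s2 psi.
(* The square of a sign is 1 unless its argument is 0, which would mean equality in the ratio
   hypothesis. *)
have eps2 : eps ^+ 2 = 1.
  rewrite /eps /epsT sqr_sg; apply/eqP; rewrite pnatr_eq1 eqb1 subr_eq0 eq_sym.
  apply: contra ratio => /eqP h; apply/eqP.
  by rewrite -[LHS](mulfK (_ : Phi s (I2 b) psi / Phi s (I1 b) psi != 0)) ?h ?mul1r ?invf_div//
    mulf_neq0 ?invr_eq0 ?gt_eqF.
have TE : Tmap s b s1 s2 psi = flip_map R b psi eps.
  apply/funext => v; apply/funext => x; rewrite /Tmap /flip_map /flip -/eps.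
  by case: ifP => _; ring.
rewrite TE; have s_gt0 : 0 < s by rewrite (lt_trans _ s12)// invr_gt0.
split.
- exact: flip_map_bounded.
- exact: flip_map_bijective.
- exists (pointval_map R b psi); split; first exact: pointval_map_compact.
  have [|alpha [beta [a0 [be0 H]]]] := weak_T_coercive R s b s1 s2 psi s12 s_lt1 b0 b1 s1_gt0 s2_lt0 Hpsi psib eps.
    by [].
  exists alpha, beta; split => //; split => // v Hv; apply: (le_trans (H v Hv)).
  have HT : Hts s (flip_map R b psi eps v).
    by have [HT _] := flip_map_bounded R s b psi s12 s_lt1 Hpsi psib eps eps2; exact: HT.
  rewrite (aformE R s b s1 s2 s1_gt0 s2_lt0 _ _ Hv HT) normrM ger0_norm//.
  by rewrite divr_ge0// ltW// Cs_gt0.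
- by move=> u Hu; exact: aform_Hdual.
- by apply: (aform_fredholm R s b s1 s2 psi).
Qed.
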